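(* Let $m\ne1$ be an odd positive integer not divisible by any prime of $\mathcal{P}_0$ nor by $31^2$. Then $S(m)\neq 0$, so $\gamma(m)=v_2(S(m))$ is defined. If $31\nmid m$, then $\gamma(31m)=\gamma(m)$. Assume now $\gcd(m,31)=1$, and write $\omega_j=\omega_j(m)$, $\gamma=\gamma(m)$. Then: (i) if $\omega_3\ne0$ and $\omega_2+\omega_4\neq0$: $\gamma=\omega_3-1$ if $\alpha'\equiv 0,1,3,4\pmod 6$; $\gamma=\omega_3$ if $\alpha'\equiv 2\pmod 6$; $\gamma=\omega_3+2$ if $\alpha'\equiv5\pmod 6$. (ii) if $\omega_2+\omega_4=0$ and $\omega_3\ge1$, let $\alpha''=\alpha'+6\ell(m)\bmod 12$ and $\delta(i)=v_2(E_i+2^{v_2(E_i)}G)$. Then: if $\omega_1+\omega_5<v_2(E_{\alpha''})$, $\gamma=\omega_3-1+\omega_1+\omega_5$; if $\omega_1+\omega_5=v_2(E_{\alpha''})$, $\gamma=\omega_3-1+\delta(\alpha'')$; if $\omega_1+\omega_5>v_2(E_{\alpha''})$, $\gamma=\omega_3-1+v_2(E_{\alpha''})$. (iii) if $\omega_3=0$ and $\omega_2+\omega_4\ne0$: $\gamma=-1+v_2(E_{\alpha'}+3^tF_{a'})$. (iv) if $\omega_3=\omega_2=\omega_4=0$ and $\omega_1+\omega_5\neq0$: $\gamma=-1+v_2\big(E_{\alpha'}+3^tF_{a'}+2^{\omega_1+\omega_5}(-1)^{\ell(m)}G\big)$.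
   Context: Let $\mathcal{A}\subseteq\mathbb{N}$ be the unique set with $\prod_{a\in\mathcal{A}}(1-z^a)^{-1}=\sum_{n\ge0}p(\mathcal{A},n)z^n\equiv1+z+z^3+z^4+z^5\pmod 2$ coefficientwise ($p(\mathcal{A},n)$ = number of partitions of $n$ into parts from $\mathcal{A}$). $\chi(\mathcal{A},\cdot)$ is its characteristic function, $\sigma(\mathcal{A},n)=\sum_{d\mid n,\,d\in\mathcal{A}}d$, and for odd $m$, $S(m)=\sum_{k\ge0}\chi(\mathcal{A},2^km)2^k\in\mathbb{Z}_2$. $v_2$ is the $2$-adic valuation. For $n$ not divisible by $31$, $\ell(n)\in\mathbb{Z}/6\mathbb{Z}$ is the unique $j$ with $n\equiv2^k3^j\pmod{31}$ for some $k\in\{0,\dots,4\}$. $\mathcal{P}_j$ ($0\le j\le5$) is the set of odd primes $p\ne31$ with $\ell(p)=j$; $\omega_j(n)$ is the number of distinct prime divisors of $n$ in $\mathcal{P}_j$. $U_j\in\mathbb{Z}_2$ ($0\le j\le5$) is defined by $U_j\equiv\sigma(\mathcal{A},2^k3^j)\pmod{2^{k+1}}$ for all $k\ge0$. $(v_i)$ is the 12-periodic sequence $(v_0,\dots,v_{11})=(2,1,1,0,-1,-1,-2,-1,-1,0,1,1)$; $E_i=\sum_{j=0}^5v_{i+2j}U_j$, $F_i=\sum_{j=0}^5v_{i+4j}U_j$ (indices mod 12), $G=\sum_{j=0}^5(-1)^jU_j$. For $m$ coprime to $31$: $\alpha'=\alpha'(m)=2\omega_5-2\omega_1+\omega_4-\omega_2-2\ell(m)\bmod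 12$, $a'=a'(m)=\omega_5-\omega_1+\omega_2-\omega_4-4\ell(m)\bmod 12$, and $t=t(m)=\lceil\frac{\omega_1+\omega_5+\omega_2+\omega_4}{2}-1\rceil-\lceil\frac{\omega_2+\omega_4}{2}-1\rceil$. *)

(* Defs.v *)
(* boolp provides the eqType and choiceType structures on nat -> int. *)
From HB Require Import structures.
From mathcomp Require Import all_boot all_order all_algebra.
From mathcomp Require Import boolp classical_sets constructive_ereal.

Set Implicit Arguments.
Unset Strict Implicit.
Unset Printing Implicit Defensive.

Import Order.TTheory GRing.Theory Num.Theory.
Local Open Scope ring_scope.

(* The ring Z_2 is the inverse limit of the Z/2^n: x n is the representative
   of x modulo 2^n in [0, 2^n).  The single condition below expresses both the
   range of x n and the compatibility of x n with x n.+1. *)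
Definition coherent (x : nat -> int) : bool :=
  `[< forall n, x n = (x n.+1 %% 2 ^+ n)%Z >].

Record Z2 := MkZ2 { res :> nat -> int; res_coherent : coherent res }.

HB.instance Definition _ := [isSub for res].
HB.instance Definition _ := [Choice of Z2 by <:].

Lemma resE (x : Z2) n : (x n.+1 %% 2 ^+ n)%Z = x n.
Proof. by have /asboolP/(_ n) := res_coherent x. Qed.

Lemma res_mod (x : Z2) n : (x n %% 2 ^+ n)%Z = x n.
Proof. by rewrite -resE modz_mod. Qed.

Lemma Z2_eqP (x y : Z2) : (forall n, x n = y n) -> x = y.
Proof. by move=> xy; apply/val_inj/funext. Qed.

(* The limit of a sequence of integers u with u n.+1 = u n mod 2^n, that is,
   the 2-adic integer congruent to u n modulo 2^n for every n. *)
Definition compatible (u : nat -> int) : Prop :=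
  forall n, (u n.+1 = u n %[mod 2 ^+ n])%Z.

Lemma modz_modX (a : int) (n : nat) :
  ((a %% 2 ^+ n.+1)%Z = a %[mod 2 ^+ n])%Z.
Proof.
rewrite [in RHS](divz_eq a (2 ^+ n.+1)) exprSr mulrCA.
by rewrite -[X in X + _]mulrC modzMDl.
Qed.

Lemma coherent_mod (u : nat -> int) :
  compatible u -> coherent (fun n => u n %% 2 ^+ n)%Z.
Proof. by move=> cu; apply/asboolP => n; rewrite modz_modX cu. Qed.

Definition Z2lim (u : nat -> int) (cu : compatible u) : Z2 :=
  MkZ2 (coherent_mod cu).

Lemma res_compatible (x : Z2) : compatible x.
Proof. by move=> n; rewrite resE res_mod. Qed.

Lemma const_compatible (a : int) : compatible (fun=> a).
Proof. by []. Qed.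

Lemma opp_compatible (x : Z2) : compatible (fun n => - x n).
Proof. by move=> n; rewrite -modzNm resE. Qed.

Lemma add_compatible (x y : Z2) : compatible (fun n => x n + y n).
Proof. by move=> n; rewrite -modzDm !resE. Qed.

Lemma mul_compatible (x y : Z2) : compatible (fun n => x n * y n).
Proof. by move=> n; rewrite -modzMm !resE. Qed.

Definition Z2zero := Z2lim (const_compatible 0).
Definition Z2one := Z2lim (const_compatible 1).
Definition Z2opp x := Z2lim (opp_compatible x).
Definition Z2add x y := Z2lim (add_compatible x y).
Definition Z2mul x y := Z2lim (mul_compatible x y).

Fact Z2addA : associative Z2add.
Proof. by move=> x y z; apply: Z2_eqP => n /=; rewrite modzDml modzDmr addrA. Qed.
Fact Z2addC : commutative Z2add.
Proof. by move=> x y; apply: Z2_eqP => n /=; rewrite addrC. Qed.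
Fact Z2add0 : left_id Z2zero Z2add.
Proof. by move=> x; apply: Z2_eqP => n /=; rewrite modzDml add0r res_mod. Qed.
Fact Z2addN : left_inverse Z2zero Z2opp Z2add.
Proof. by move=> x; apply: Z2_eqP => n /=; rewrite modzDml addNr. Qed.

HB.instance Definition _ :=
  GRing.isZmodule.Build Z2 Z2addA Z2addC Z2add0 Z2addN.

Fact Z2mulA : associative Z2mul.
Proof. by move=> x y z; apply: Z2_eqP => n /=; rewrite modzMml modzMmr mulrA. Qed.
Fact Z2mulC : commutative Z2mul.
Proof. by move=> x y; apply: Z2_eqP => n /=; rewrite mulrC. Qed.
Fact Z2mul1 : left_id Z2one Z2mul.
Proof. by move=> x; apply: Z2_eqP => n /=; rewrite modzMml mul1r res_mod. Qed.
Fact Z2mulD : left_distributive Z2mul Z2add.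
Proof.
by move=> x y z; apply: Z2_eqP => n /=; rewrite modzMml mulrDl modzDmr modzDml.
Qed.
Fact Z2one_neq0 : Z2one != 0 :> Z2.
Proof. by apply/eqP => /(congr1 (fun x : Z2 => x 1%N)). Qed.

HB.instance Definition _ :=
  GRing.Zmodule_isComNzRing.Build Z2 Z2mulA Z2mulC Z2mul1 Z2mulD Z2one_neq0.

Definition Z2dvd (x y : Z2) : Prop := exists z : Z2, y = x * z.

(* The 2-adic valuation, with value +oo at 0. *)
Definition v2 (x : Z2) : \bar int :=
  if x == 0 then +oo%E
  else ((xget 0%N [set k | Z2dvd (2 ^+ k) x /\ ~ Z2dvd (2 ^+ k.+1) x])%:Z)%:E.

(* 2 ^ e for a valuation e, with 2 ^ (+oo) = 0 (the limit of 2 ^ n in Z_2). *)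
Definition pow2 (e : \bar int) : Z2 :=
  if e is (k%:E)%E then 2 ^+ `|k|%N else 0.

Lemma natr_compatible (a : nat) n : (a%:R : Z2) n = (a%:Z %% 2 ^+ n)%Z.
Proof.
elim: a => [|a IH]; first by [].
rewrite -[a.+1]addn1 natrD PoszD.
change ((((a%:R : Z2) n + (1 : Z2) n)%R %% 2 ^+ n)%Z = ((a%:Z + 1)%R %% 2 ^+ n)%Z).
by rewrite IH -[(1 : Z2) n]/((1 : int) %% 2 ^+ n)%Z modzDm.
Qed.

Lemma Z2dvd_res k (x : Z2) : Z2dvd (2 ^+ k) x -> x k = 0.
Proof.
move=> [y ->]; change ((((2 ^+ k : Z2) k * y k)%R %% 2 ^+ k)%Z = 0).
have -> : (2 ^+ k : Z2) = (2 ^ k)%N%:R by rewrite natrX.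
by rewrite natr_compatible -natz natrX modzz mul0r mod0z.
Qed.

Lemma Z2dvdX i j (x : Z2) : (i <= j)%N -> Z2dvd (2 ^+ j) x -> Z2dvd (2 ^+ i) x.
Proof.
by move=> /subnKC <- [y ->]; exists (2 ^+ (j - i) * y); rewrite mulrA -exprD.
Qed.

Lemma v2P (x : Z2) (k : nat) :
  v2 x = (k%:Z)%:E%E <-> Z2dvd (2 ^+ k) x /\ ~ Z2dvd (2 ^+ k.+1) x.
Proof.
have uniq_k i j : Z2dvd (2 ^+ i) x /\ ~ Z2dvd (2 ^+ i.+1) x ->
    Z2dvd (2 ^+ j) x /\ ~ Z2dvd (2 ^+ j.+1) x -> i = j.
  move=> [ai bi] [aj bj]; apply/eqP; rewrite eqn_leq.
  apply/andP; split; rewrite leqNgt; apply/negP => lt_ij.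
    by apply: bj; apply: Z2dvdX ai.
  by apply: bi; apply: Z2dvdX aj.
rewrite /v2; case: eqVneq => [->|x0].
  by split=> // -[_ []]; exists 0; rewrite mulr0.
case: xgetP => [i _ Pi|noP].
  split=> [[<-] // | Pk]; congr (_%:E)%E; congr Posz; exact: uniq_k.
suff [i Pi] : exists i, Z2dvd (2 ^+ i) x /\ ~ Z2dvd (2 ^+ i.+1) x by case: (noP i).
have exi : exists i, ~~ `[< Z2dvd (2 ^+ i.+1) x >].
  apply: contrapT => /forallNP all_dvd; move/eqP: x0; apply.
  apply: Z2_eqP => n; rewrite (_ : (0 : Z2) n = 0); last exact: mod0z.
  apply: Z2dvd_res; apply: (@Z2dvdX _ n.+1) => //; apply/asboolP.
  by apply/negPn/negP/all_dvd.
case: (ex_minnP exi) => -[|i] /asboolPn Pi min_i.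
  by exists 0%N; split=> //; exists x; rewrite mul1r.
exists i.+1; split=> //; apply/asboolP/negPn/negP => /min_i.
by rewrite ltnn.
Qed.

(* The number p(A, n) of partitions of n into parts from A: f i is the number
   of parts equal to i.+1. *)
Definition npart (A : {pred nat}) (n : nat) : nat :=
  #|[set f : {ffun 'I_n -> 'I_n.+1} |
      ((\sum_(i < n) f i * i.+1)%N == n)
      && [forall i, (0 < f i)%N ==> (i.+1 \in A)]]|.

Definition Ppoly : {poly 'F_2} := 1 + 'X + 'X^3 + 'X^4 + 'X^5.

Definition is_calA (A : {pred nat}) : Prop :=
  0%N \notin A /\ forall n, (npart A n)%:R = Ppoly`_n :> 'F_2.

Lemma eq_npart (A B : {pred nat}) (n : nat) :
  (forall i, (0 < i <= n)%N -> (i \in A) = (i \in B)) -> npart A n = npart B n.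
Proof.
move=> AB; rewrite /npart; apply: eq_card => f; rewrite !inE.
by congr (_ && _); apply: eq_forallb => i; rewrite AB ?ltn_ord.
Qed.

Lemma npart_rec (A : {pred nat}) (n : nat) :
  npart A n.+1 = (npart [predD1 A & n.+1] n.+1 + (n.+1 \in A))%N.
Proof.
rewrite /npart -(cardsID [set f : {ffun 'I_n.+1 -> 'I_n.+2} | f ord_max == 0]).
congr (_ + _)%N.
  apply: eq_card => f; rewrite !inE -andbA; congr (_ && _).
  apply/andP/forallP => [[/forallP fA /eqP f0] i | fA].
    apply/implyP => fi; rewrite !inE (implyP (fA i) fi) andbT eqSS.
    by apply: contraTneq fi => in_; rewrite (_ : i = ord_max) ?f0 //; apply: val_inj.
  split; last first.
    by have := fA ord_max; rewrite !inE eqxx implybF lt0n negbK.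
  apply/forallP => i; apply/implyP => /(implyP (fA i)).
  by rewrite !inE => /andP[].
pose f0 : {ffun 'I_n.+1 -> 'I_n.+2} := [ffun i => inord (i == ord_max)].
have f0E i : f0 i = (i == ord_max) :> nat.
  by rewrite ffunE inordK //; case: (_ == _).
have sumE (f : {ffun 'I_n.+1 -> 'I_n.+2}) : f ord_max != 0 ->
    (\sum_(i < n.+1) f i * i.+1)%N == n.+1 -> f = f0.
  rewrite -lt0n (bigD1 ord_max) //= => fmax /eqP sum_f.
  have f1 : f ord_max = 1%N :> nat.
    case: (nat_of_ord (f ord_max)) fmax sum_f => [|[|k]] // _.
    by rewrite mulSn mulSn => /eqP; rewrite -!addnA -[X in _ == X]addn0 eqn_add2l.
  move: sum_f; rewrite f1 mul1n => /eqP.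
  rewrite -[X in _ == X]addn0 eqn_add2l sum_nat_eq0 => /forallP f_0.
  apply/ffunP => i; apply: val_inj; rewrite /= f0E.
  case: eqVneq => [-> // | ni]; have := f_0 i.
  by rewrite ni /= muln_eq0 orbF => /eqP.
case An: (n.+1 \in A).
  rewrite (_ : _ :\: _ = [set f0]) ?cards1 //; apply/setP => f; rewrite !inE.
  apply/andP/eqP => [[fm /andP[sf _]] | ->]; first exact: sumE.
  split; first by rewrite -val_eqE /= f0E eqxx.
  apply/andP; split.
    rewrite (bigD1 ord_max) //= f0E eqxx mul1n big1 ?addn0 // => i ni.
    by rewrite f0E (negPf ni).
  by apply/forallP => i; rewrite f0E; case: eqVneq => [-> | ].
rewrite (_ : _ :\: _ = finset.set0) ?cards0 //; apply/setP => f; rewrite !inE.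
apply/negP => /andP[fm /andP[sf /forallP/(_ ord_max)]].
by rewrite lt0n fm An.
Qed.

(* The elements of A up to n, obtained greedily. *)
Fixpoint partsA (n : nat) : seq nat :=
  if n is m.+1 then
    if (npart (mem (partsA m)) n)%:R == Ppoly`_n then partsA m
    else n :: partsA m
  else [::].

Lemma calA_exists_unique :
  exists2 A : {pred nat}, is_calA A & forall B, is_calA B -> B =i A.
Proof.
have le_parts n i : i \in partsA n -> (i <= n)%N.
  elim: n => //= n IH; case: ifP => _; first by move/IH/leqW.
  by rewrite inE => /predU1P[-> // | /IH/leqW].
have npart0 B : npart B 0 = 1%N.
  rewrite /npart -[RHS](cards1 [ffun i : 'I_0 => ord0 : 'I_1]).
  apply: eq_card => f; rewrite !inE big_ord0 eqxx /=.
  rewrite (_ : [forall i, _] = true); last by apply/forallP; case.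
  by apply/esym/eqP/ffunP; case.
have F2E (b c : bool) : b%:R = c%:R :> 'F_2 -> b = c by case: b c => -[].
pose A : {pred nat} := [pred n | n \in partsA n].
have AE n i : (i <= n)%N -> (i \in partsA n) = (i \in A).
  elim: n => [|n IH]; first by rewrite leqn0 => /eqP->.
  rewrite leq_eqVlt => /predU1P[-> // | lt_in].
  rewrite -IH //=; case: ifP => // _; rewrite inE.
  by rewrite (ltn_eqF lt_in).
have pA n : (npart A n)%:R = Ppoly`_n :> 'F_2.
  case: n => [|n].
    by rewrite npart0 /Ppoly !coefD coef1 coefX !coefXn; apply: val_inj.
  rewrite npart_rec natrD.
  have -> : npart [predD1 A & n.+1] n.+1 = npart (mem (partsA n)) n.+1.
    apply: eq_npart => i /andP[i0]; rewrite !inE.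
    rewrite leq_eqVlt => /predU1P[-> | lt_in].
      by rewrite eqxx /=; apply/esym/negP => /le_parts; rewrite ltnn.
    by rewrite (ltn_eqF lt_in) /=; apply/esym/AE.
  have -> : (n.+1 \in A) =
      ((npart (mem (partsA n)) n.+1)%:R != Ppoly`_n.+1 :> 'F_2).
    rewrite inE /=; case: ifP => _; last by rewrite inE eqxx.
    by apply/negP => /le_parts; rewrite ltnn.
  case: eqVneq => [-> | ]; first by rewrite addr0.
  by move: (_%:R : 'F_2) (Ppoly`_n.+1) => -[[|[|?]] ?] -[[|[|?]] ?] // ?;
     apply: val_inj.
exists A; first by split.
move=> B [B0 pB] n; elim/ltn_ind: n => -[_ | n IH]; first by rewrite (negPf B0).
apply: F2E; apply: (@addrI _ (npart [predD1 B & n.+1] n.+1)%:R).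
rewrite -natrD -npart_rec pB -pA npart_rec natrD; congr (_%:R + _).
apply: eq_npart => i /andP[i0 lei]; rewrite !inE; case: eqVneq => //= ni.
by rewrite IH // ltn_neqAle ni.
Qed.

Definition sigma (A : {pred nat}) (n : nat) : nat :=
  (\sum_(d <- divisors n | d \in A) d)%N.

Section Adic.
Variable A : {pred nat}.

Lemma S_compatible (m : nat) :
  compatible (fun n => \sum_(0 <= k < n) ((2 ^ k * m)%N \in A)%:Z * 2 ^+ k).
Proof. by move=> n; rewrite big_nat_recr //= addrC modzMDl. Qed.

Definition S_ (m : nat) : Z2 := Z2lim (@S_compatible m).

Definition gamma (m : nat) : \bar int := v2 (S_ m).

Lemma sigma_compatible (m k : nat) : odd m ->
  sigma A (2 ^ k.+1 * m) = sigma A (2 ^ k * m) %[mod 2 ^ k.+1].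
Proof.
move=> om; have m0 : (0 < m)%N by case: (m) om.
have N0 j : (0 < 2 ^ j * m)%N by rewrite muln_gt0 expn_gt0 m0.
rewrite {1}/sigma (bigID (fun d => d %| 2 ^ k * m)%N) /=.
have -> : (\sum_(d <- divisors (2 ^ k.+1 * m) | (d \in A) && (d %| 2 ^ k * m)) d
           = sigma A (2 ^ k * m))%N.
  rewrite /sigma; under eq_bigl do rewrite andbC.
  rewrite -big_filter_cond; apply: perm_big; apply: uniq_perm.
  - by rewrite filter_uniq // divisors_uniq.
  - exact: divisors_uniq.
  move=> d; rewrite mem_filter -!dvdn_divisors //; apply: andb_idr => dv.
  by apply: dvdn_trans dv _; rewrite expnS -mulnA dvdn_mull.
rewrite -modnDmr (_ : (\sum_(d <- _ | _) d) %% _ = 0)%N ?addn0 //.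
apply/eqP; rewrite -/(dvdn _ _) big_seq_cond; apply: dvdn_sum => d.
rewrite -dvdn_divisors // => /andP[dv /andP[_ ndv]].
have d0 : (0 < d)%N by apply: dvdn_gt0 dv.
rewrite pfactor_dvdn // ltnNge; apply: contra ndv => le_k.
have kE : (d = d`_2 * d`_(2^')%N)%N by rewrite partnC.
rewrite kE p_part; apply: dvdn_mul; first exact: dvdn_exp2l.
have cop : coprime d`_(2^')%N (2 ^ k.+1).
  by rewrite coprime_sym; apply: (@pnat_coprime 2%N); rewrite ?part_pnat ?pnatX ?pnat_id.
by rewrite -(Gauss_dvdr _ cop); apply: dvdn_trans dv; exact: dvdn_part.
Qed.

(* U_ j modulo 2^(k+1) is sigma(A, 2^k 3^j); hence the shift in the index. *)
Lemma U_compatible (j : nat) :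
  compatible (fun n => (sigma A (2 ^ n.-1 * 3 ^ j))%:Z).
Proof.
case=> [|n] /=; first by rewrite !modz1.
have -> : 2 ^+ n.+1 = (2 ^ n.+1)%N%:Z by rewrite -!natz natrX.
by rewrite !modz_nat sigma_compatible // oddX orbT.
Qed.

Definition U_ (j : nat) : Z2 := Z2lim (@U_compatible j).

Lemma U_P j k : (U_ j k.+1 = (sigma A (2 ^ k * 3 ^ j))%:Z %[mod 2 ^+ k.+1])%Z.
Proof. exact: modz_mod. Qed.

Definition v_ (i : int) : int :=
  nth 0 [:: 2; 1; 1; 0; -1; -1; -2; -1; -1; 0; 1; 1] `|(i %% 12)%Z|.

Definition E_ (i : int) : Z2 := \sum_(j < 6) (v_ (i + 2 * j%:Z))%:~R * U_ j.
Definition F_ (i : int) : Z2 := \sum_(j < 6) (v_ (i + 4 * j%:Z))%:~R * U_ j.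
Definition G_ : Z2 := \sum_(j < 6) (-1) ^+ j * U_ j.

Definition delta (i : int) : \bar int := v2 (E_ i + pow2 (v2 (E_ i)) * G_).

End Adic.

(* The value is meaningful only when 31 does not divide n; see ellP. *)
Definition ell (n : nat) : 'Z_6 :=
  odflt 0 [pick j : 'Z_6 | [exists k : 'I_5, n == 2 ^ k * 3 ^ j %[mod 31]]].

Lemma ellP (n : nat) (j : 'Z_6) : ~~ (31 %| n)%N ->
  ell n = j <-> exists2 k : nat, (k <= 4)%N & n = 2 ^ k * 3 ^ j %[mod 31].
Proof.
pose c r j := has (fun k => r == 2 ^ k * 3 ^ j %% 31)%N (iota 0 5).
have all1 : all (fun r => has (c r) (iota 0 6) && all (fun i => all (fun j =>
    c r i && c r j ==> (i == j)) (iota 0 6)) (iota 0 6)) (iota 1 30).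
  by vm_compute.
move=> n31; have n30 : (n %% 31)%N \in iota 1 30.
  by rewrite mem_iota lt0n n31 ltn_mod.
have /(allP all1)/andP[ex_i uniq_ij] := n30.
have cP (i : 'Z_6) : reflect
    (exists2 k : nat, (k <= 4)%N & n = 2 ^ k * 3 ^ i %[mod 31]) (c (n %% 31)%N i).
  apply: (iffP hasP) => [[k] | [k k4 /eqP nk]]; last first.
    by exists k; [rewrite mem_iota | exact: nk].
  by rewrite mem_iota => k4 /eqP nk; exists k; [exact: k4 | exact: nk].
have cE (i : 'Z_6) :
    [exists k : 'I_5, n == 2 ^ k * 3 ^ i %[mod 31]] = c (n %% 31)%N i.
  apply/existsP/cP => [[k /eqP nk] | [k k4 nk]].
    by exists k; [rewrite -ltnS; exact: ltn_ord | exact: nk].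
  by exists (Ordinal (k4 : (k < 5)%N)); apply/eqP.
have c_inj (i i' : 'Z_6) : c (n %% 31)%N i -> c (n %% 31)%N i' -> i = i'.
  move=> ci ci'; apply/val_inj/eqP.
  have mem6 (l : 'Z_6) : val l \in iota 0 6 by rewrite mem_iota /= (ltn_ord l).
  move/allP: uniq_ij => /(_ _ (mem6 i))/allP/(_ _ (mem6 i')).
  by rewrite ci ci'.
rewrite /ell; case: pickP => [i | no_i].
  rewrite cE => ci; split=> [<- | /cP]; [exact/cP | exact: c_inj].
case/hasP: ex_i => i; rewrite mem_iota /= => lt_i.
by have := no_i (Ordinal (lt_i : (i < (Zp_trunc 6).+2)%N)); rewrite cE /= => ->.
Qed.

Definition calP (j : 'Z_6) : {pred nat} :=
  [pred p | [&& prime p, odd p, p != 31 & ell p == j]].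

Definition omega (j : 'Z_6) (n : nat) : nat := count (mem (calP j)) (primes n).
Arguments omega j%_R n%_N.

Definition alpha' (m : nat) : int :=
  ((2 * (omega 5 m)%:Z - 2 * (omega 1 m)%:Z + (omega 4 m)%:Z - (omega 2 m)%:Z
    - 2 * (ell m : nat)%:Z) %% 12)%Z.

Definition alpha'' (m : nat) : int :=
  ((alpha' m + 6 * (ell m : nat)%:Z) %% 12)%Z.

Definition a' (m : nat) : int :=
  (((omega 5 m)%:Z - (omega 1 m)%:Z + (omega 2 m)%:Z - (omega 4 m)%:Z
    - 4 * (ell m : nat)%:Z) %% 12)%Z.

(* Nonnegative by tz_ge0, so that t_ below is a natural number. *)
Definition tz (m : nat) : int :=
  Num.ceil ((omega 1 m + omega 5 m + omega 2 m + omega 4 m)%:R / 2 - 1 : rat)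
  - Num.ceil ((omega 2 m + omega 4 m)%:R / 2 - 1 : rat).

Lemma tz_ge0 (m : nat) : 0 <= tz m.
Proof.
rewrite subr_ge0 le_ceil // lerD2r ler_pM2r // ler_nat -addnA leq_addl //.
Qed.

Definition t_ (m : nat) : nat := `|tz m|%N.

(* Main.v *)
(* The generating function of A is P modulo 2, so comparing logarithmic
   derivatives gives sigma(A, n) = - t(n) modulo 2^(v_2(n) + 1), where t(n) is the
   sum of the nth powers of the roots of the reciprocal of P.  These roots have
   order 31 modulo 2, so t(2^k n) tends to - W(n) in Z_2, where W has period 31, is
   invariant under doubling and satisfies the multiplication rule of Gaussian
   periods; W(3^j) is U_j.

   Since W(n) is the sum of d S(d) over the divisors d of n, Moebius inversion writes
   m S(m) as the value of x^l(m) prod_(p | m) (1 - x^(- l(p))) in Z[x]/(x^6 - 1) under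
   x^j |-> U_j.  Expanding along the characters of Z/6 gives 6 m S(m) in terms of E, F
   and G.  The U_j are linearly independent over Z because the cyclotomic polynomial
   of order 31 is irreducible, hence S(m) <> 0; the valuations of the E_i come from
   the U_j modulo 16. *)
Require Import Defs.
From mathcomp Require Import all_boot all_order all_algebra all_field.
From mathcomp Require Import boolp constructive_ereal.
From mathcomp Require Import zify ring lra.

Set Implicit Arguments.
Unset Strict Implicit.
Unset Printing Implicit Defensive.

Import Order.TTheory GRing.Theory Num.Theory.
Local Open Scope ring_scope.

(** * Logarithmic derivatives modulo X^(N+1) *)

(** No 2-adic extension is constructed. The roots are replaced by the integer sequence [tr] and by
    the linear functional X^n |-> tr n, which vanishes on multiples of [Prec]: a polynomial
    congruence modulo [Prec] and 2^(k+1) becomes a congruence between power sums, and [W] is their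
    limit. The difficulty is precision: since X^31 = 1 is available modulo 2 only, a congruence at
    the exponent a is obtained modulo 2^(k+1) when 2^k divides a. The multiplication rule needs y_a,
    the sum of X^(2^i a) over i < 5, to be a scalar to that precision. Modulo 2 it is a trace from
    F_32; further digits come from y_a^2 = y_a + 2 (y_3a + y_5a), whose factor 2 gains one digit at
    a time. At a nontrivial character each factor 1 - x^(-l) has absolute value 0, 1, sqrt 3 or 2.
    The zeros produce the case distinction, the values sqrt 3 the normalisation of [v_] and the
    power 3^t, the values 2 the powers of 2. *)

Definition eq_upto (N : nat) (p q : {poly int}) :=
  forall i, (i <= N)%N -> p`_i = q`_i.

Section Truncation.
Variable N : nat.
Implicit Types p q w : {poly int}.

Lemma eq_upto_refl p : eq_upto N p p.
Proof. by []. Qed.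

Lemma eq_upto_sym p q : eq_upto N p q -> eq_upto N q p.
Proof. by move=> pq i iN; rewrite pq. Qed.

Lemma eq_upto_trans q p r : eq_upto N p q -> eq_upto N q r -> eq_upto N p r.
Proof. by move=> pq qr i iN; rewrite pq ?qr. Qed.

Lemma eq_uptoD p q p' q' :
  eq_upto N p q -> eq_upto N p' q' -> eq_upto N (p + p') (q + q').
Proof. by move=> pq pq' i iN; rewrite !coefD pq ?pq'. Qed.

Lemma eq_uptoN p q : eq_upto N p q -> eq_upto N (- p) (- q).
Proof. by move=> pq i iN; rewrite !coefN pq. Qed.

Lemma eq_uptoM p q p' q' :
  eq_upto N p q -> eq_upto N p' q' -> eq_upto N (p * p') (q * q').
Proof.
move=> pq pq' i iN; rewrite !coefM; apply: eq_bigr => j _.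
by rewrite pq ?pq' //; have := ltn_ord j; lia.
Qed.

Lemma eq_upto_prod (I : Type) (r : seq I) (P : pred I) (f g : I -> {poly int}) :
  (forall i, P i -> eq_upto N (f i) (g i)) ->
  eq_upto N (\prod_(i <- r | P i) f i) (\prod_(i <- r | P i) g i).
Proof.
by move=> fg; apply: (big_ind2 (eq_upto N)) => // *; exact: eq_uptoM.
Qed.

Lemma eq_upto_Xn p n : (N < n)%N -> eq_upto N ('X^n * p) 0.
Proof. by move=> Nn i iN; rewrite coefXnM coef0 (leq_ltn_trans iN Nn). Qed.

Lemma eq_upto_Xderiv p q :
  eq_upto N p q -> eq_upto N ('X * p^`()) ('X * q^`()).
Proof.
by move=> pq [|i] iN; rewrite !coefXM //= !coef_deriv pq.
Qed.

(* q is invertible as a power series as soon as it has an inverse g up to X^N. *)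
Lemma eq_upto_cancel q g p p' : eq_upto N (q * g) 1 ->
  eq_upto N (q * p) (q * p') -> eq_upto N p p'.
Proof.
move=> qg pp'.
have E r : eq_upto N (g * (q * r)) r.
  rewrite mulrA (mulrC g) -[X in eq_upto _ _ X]mul1r; exact: eq_uptoM.
apply: eq_upto_trans (eq_upto_sym (E p)) _; apply: eq_upto_trans (E p').
exact: eq_uptoM.
Qed.

Definition logder q w := eq_upto N ('X * q^`()) (q * w).

Lemma logder_eq q q' w : eq_upto N q q' -> logder q w -> logder q' w.
Proof.
move=> qq' Lq; apply: eq_upto_trans (eq_upto_Xderiv (eq_upto_sym qq')) _.
by apply: eq_upto_trans Lq _; apply: eq_uptoM.
Qed.

Lemma logderM q w q' w' : logder q w -> logder q' w' -> logder (q * q') (w + w').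
Proof.
move=> Lq Lq'.
rewrite /logder derivM (_ : 'X * _ = 'X * q^`() * q' + q * ('X * q'^`())); last by ring.
rewrite (_ : q * q' * _ = q * w * q' + q * (q' * w')); last by ring.
by apply: eq_uptoD; apply: eq_uptoM.
Qed.

Lemma logder1 : logder 1 0.
Proof. by rewrite /logder derivE mulr0 mulr0. Qed.

Lemma logder_prod (I : Type) (r : seq I) (P : pred I) (f g : I -> {poly int}) :
  (forall i, P i -> logder (f i) (g i)) ->
  logder (\prod_(i <- r | P i) f i) (\sum_(i <- r | P i) g i).
Proof.
by move=> fg; apply: (big_ind2 logder) => // *; [exact: logder1|exact: logderM].
Qed.

Lemma logderV q g w : eq_upto N (q * g) 1 -> logder q w -> logder g (- w).
Proof.
move=> qg Lq; apply: (eq_upto_cancel qg).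
have L0 : eq_upto N ('X * (q * g)^`()) 0.
  by apply: eq_upto_trans (eq_upto_Xderiv qg) _; rewrite derivE mulr0.
have -> : q * ('X * g^`()) = 'X * (q * g)^`() - 'X * q^`() * g.
  by rewrite derivM; ring.
have -> : q * (g * - w) = 0 - q * w * g by ring.
by apply: eq_uptoD => //; apply: eq_uptoN; apply: eq_uptoM.
Qed.

Definition geom (b : int) (a : nat) : {poly int} :=
  \sum_(j < N.+1) (b ^+ j) *: 'X^(a * j).

Lemma geomP b a : (0 < a)%N -> eq_upto N ((1 - b *: 'X^a) * geom b a) 1.
Proof.
move=> a0.
have -> : geom b a = \sum_(j < N.+1) (b *: 'X^a) ^+ j.
  by apply: eq_bigr => j _; rewrite exprZn -exprM.
rewrite -opprB mulNr -subrX1 opprB exprZn -exprM -[X in eq_upto _ _ X]subr0.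
apply: eq_uptoD => //; apply: eq_uptoN; rewrite -mul_polyC mulrC.
by apply: eq_upto_Xn; nia.
Qed.

Lemma logder_geom b a : (0 < a)%N ->
  logder (1 - b *: 'X^a) (- (\sum_(1 <= j < N.+1) (b ^+ j *+ a) *: 'X^(a * j))).
Proof.
move=> a0; rewrite /logder.
have -> : 'X * (1 - b *: 'X^a)^`() = (1 - b *: 'X^a - 1) *+ a.
  rewrite derivB derivZ derivXn derivE sub0r addrAC subrr add0r.
  by rewrite -[X in _ = - (_ *: 'X^X) *+ _](prednK a0) exprS mulrN -!scalerAr
             mulrnAr mulNrn scalerMnr.
have -> : \sum_(1 <= j < N.+1) (b ^+ j *+ a) *: 'X^(a * j)
        = (geom b a - 1) *+ a.
  rewrite /geom -(big_mkord xpredT (fun j => b ^+ j *: 'X^(a * j))).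
  rewrite big_nat_recl // expr0 muln0 expr0 scale1r addrC addKr.
  by rewrite big_add1 -sumrMnl; apply: eq_bigr => j _; rewrite scalerMnl.
rewrite mulrN mulrnAr mulrBr mulr1 -mulNrn opprB.
by move=> i iN; rewrite !coefMn !coefB (geomP b a0).
Qed.

End Truncation.

Lemma pow2_Posz n : (2 : int) ^+ n = (2 ^ n)%N%:Z.
Proof. by rewrite -[in RHS]natz natrX. Qed.

(** The valuation of j is at most j - 1, so the j factors 2 of c^j outweigh what j contributes to a
    j, by at least one. *)
Lemma even_pow_dvdn a j v (c : int) : (0 < j)%N -> (2 %| c)%Z -> (2 ^ v %| a * j)%N ->
  (2 ^+ v.+1 %| c ^+ j *+ a)%Z.
Proof.
move=> j0 c2 dv.
suff : (2 ^ v.+1 %| 2 ^ j * a)%N.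
  rewrite -mulr_natr => dvj.
  apply: (@dvdz_trans (2 ^+ j * a%:R)); last by apply: dvdz_mul => //; exact: dvdz_exp2r.
  by rewrite !pow2_Posz (natz a) -PoszM.
case: (posnP a) => [->|a0]; first by rewrite muln0 dvdn0.
move: dv; rewrite !pfactor_dvdn ?muln_gt0 ?expn_gt0 ?a0 //.
rewrite !lognM ?expn_gt0 // pfactorK //.
have : (logn 2 j < j)%N by apply: ltn_logl.
lia.
Qed.

(* Peel off the factors 1 - b X^m with b even one at a time. *)
Lemma logder_even N (q w : {poly int}) : q`_0 = 1 -> (forall i, (i <= N)%N -> (2 %| (q - 1)`_i)%Z) ->
  logder N q w -> forall v n, (0 < n <= N)%N -> (2 ^ v %| n)%N -> (2 ^+ v.+1 %| w`_n)%Z.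
Proof.
pose lowzero m (q : {poly int}) := forall i, (0 < i < m)%N -> (i <= N)%N -> q`_i = 0.
suff main k : forall m (q w : {poly int}), (N.+1 - m <= k)%N -> (0 < m)%N -> lowzero m q ->
    q`_0 = 1 -> (forall i, (i <= N)%N -> (2 %| (q - 1)`_i)%Z) ->
  logder N q w -> forall v n, (0 < n <= N)%N -> (2 ^ v %| n)%N -> (2 ^+ v.+1 %| w`_n)%Z.
  by move=> q0 qe Lq; apply: (main N.+1 1%N q) => // [|i]; lia.
elim: k => [|k IH] m {}q {}w Nm m0 lq q0 qe Lq v n n0 dv.
  have q1 : eq_upto N q 1.
    move=> [|i] iN; first by rewrite q0 coef1.
    by rewrite coef1 lq //; lia.
  have := logder_eq q1 Lq; rewrite /logder derivE mulr0 mul1r => /(_ n).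
  by rewrite coef0 => <- //; lia.
case: (leqP m N) => mN; last first.
  by apply: (IH m q w) => //; lia.
pose b := - q`_m.
have b2 : (2 %| b)%Z.
  by have := qe m mN; rewrite coefB coef1 (gtn_eqF m0) subr0 /b rpredN.
pose w1 : {poly int} := - \sum_(1 <= j < N.+1) (b ^+ j *+ m) *: 'X^(m * j).
have L1 : logder N (1 - b *: 'X^m) w1 by apply: logder_geom.
have Gi := @geomP N b m m0.
(* Division by 1 - b X^m: as b is minus the coefficient of X^m in q, that coefficient vanishes in
   the quotient. *)
pose q2 := q * geom N b m.
have L2 : logder N q2 (w - w1) := logderM Lq (logderV Gi L1).
have GE (i : nat) : (geom N b m)`_i =
   if (m %| i)%N && (i %/ m <= N)%N then b ^+ (i %/ m) else 0.
  rewrite coef_sum; case: ifP => [/andP[/dvdnP[j iE]]|]; last first.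
    move=> nd; apply: big1 => j _; rewrite coefZ coefXn.
    case: eqP => [iE|]; last by rewrite mulr0.
    by move: nd; rewrite iE dvdn_mulr // mulKn // -ltnS ltn_ord.
  rewrite {}iE mulnK // => jN; rewrite (bigD1 (inord j)) //= big1 ?addr0.
    by rewrite coefZ coefXn inordK // mulnC eqxx mulr1.
  move=> l lj; rewrite coefZ coefXn mulnC eqn_pmul2l //.
  case: eqP => [jl|_]; last by rewrite mulr0.
  by move: lj; rewrite jl inord_val eqxx.
have G0 : (geom N b m)`_0 = 1 by rewrite GE dvdn0 div0n.
have w1e : (2 ^+ v.+1 %| w1`_n)%Z.
  rewrite /w1 coefN rpredN coef_sum big_nat.
  apply: (big_ind (fun x => 2 ^+ v.+1 %| x)%Z); rewrite ?dvdz0 //.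
    by move=> *; rewrite rpredD.
  move=> j j0.
  rewrite coefZ coefXn; case: eqP => [nE|]; last by rewrite mulr0 dvdz0.
  by rewrite mulr1; apply: even_pow_dvdn; rewrite // -?nE //; lia.
have -> : w = (w - w1) + w1 by rewrite subrK.
rewrite coefD rpredD //.
apply: (IH m.+1 q2 (w - w1)) => //; first by lia.
- move=> i im iN; rewrite /q2 coefM.
  case: (ltnP i m) => lim.
    rewrite big_ord_recl big1 /= ?addr0 => [|j _].
      by rewrite subn0 q0 mul1r GE; case: ifP => // /andP[/dvdnP[l iE] _]; case: l iE => [|l] iE; nia.
    by rewrite lq ?mul0r // /bump; have := ltn_ord j; lia.
  have {im lim} -> : i = m by lia.
  rewrite big_ord_recr /= subnn G0 mulr1 (bigD1 (Ordinal m0)) //= q0 mul1r subn0.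
  rewrite big1 ?addr0 => [|j jm].
    by rewrite GE dvdnn divnn m0 (leq_trans m0 mN) expr1 /b addNr.
  rewrite lq ?mul0r //; have := ltn_ord j; last by lia.
  by move: jm; rewrite -val_eqE /=; lia.
- by rewrite /q2 coefM big_ord_recl big_ord0 /= q0 G0 mulr1 addr0.
move=> i iN; have -> : q2 - 1 = (q - 1) * geom N b m + (geom N b m - 1).
  by rewrite /q2 mulrBl mul1r addrA subrK.
rewrite coefD rpredD //.
  rewrite coefM; apply: (big_ind (fun x => 2 %| x)%Z); rewrite ?dvdz0 //.
    by move=> *; rewrite rpredD.
  move=> j _.
  by rewrite dvdz_mulr // qe //; have := ltn_ord j; lia.
rewrite coefB GE coef1; case: i iN => [|i] iN; first by rewrite dvdn0 div0n.
rewrite subr0; case: ifP => [/andP[/dvdnP[[|j] // ->] _]|_]; last exact: dvdz0.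
by rewrite mulnK // exprS dvdz_mulr.
Qed.

(** * Power sums of the roots of the reciprocal of P *)

Section Functional.
Variables (R : comNzRingType) (u : nat -> R).

(** For u = [tr] this is the trace of the class of p modulo [Prec]. *)
Definition umbral (p : {poly int}) : R := \sum_(i < size p) (p`_i)%:~R * u i.

Lemma umbral_widen n (p : {poly int}) : (size p <= n)%N ->
  umbral p = \sum_(i < n) (p`_i)%:~R * u i.
Proof.
move=> pn; rewrite /umbral (big_ord_widen n (fun i => (p`_i)%:~R * u i)) //.
rewrite big_mkcond; apply: eq_bigr => i _; case: ltnP => // le_i.
by rewrite nth_default ?mul0r.
Qed.

Lemma umbralD p q : umbral (p + q) = umbral p + umbral q.
Proof.
pose n := maxn (size (p + q)%R) (maxn (size p) (size q)).
rewrite !(@umbral_widen n) ?leq_max ?leqnn ?orbT //.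
by rewrite -big_split; apply: eq_bigr => i _; rewrite coefD intrD mulrDl.
Qed.

Lemma umbralC c p : umbral (c%:P * p) = c%:~R * umbral p.
Proof.
rewrite !(@umbral_widen (maxn (size (c%:P * p)) (size p))) ?leq_max ?leqnn ?orbT //.
by rewrite mulr_sumr; apply: eq_bigr => i _; rewrite coefCM intrM mulrA.
Qed.

Lemma umbralB p q : umbral (p - q) = umbral p - umbral q.
Proof. by rewrite umbralD -mulN1r -polyCN umbralC rmorphN mulN1r. Qed.

Lemma umbralX n : umbral 'X^n = u n.
Proof.
rewrite /umbral size_polyXn big_ord_recr /= big1 ?add0r => [|i _].
  by rewrite coefXn eqxx mul1r.
by rewrite coefXn (ltn_eqF (ltn_ord i)) mul0r.
Qed.

Lemma umbral0 : umbral 0 = 0.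
Proof. by rewrite /umbral size_poly0 big_ord0. Qed.

Lemma umbral_sum (I : Type) (r : seq I) (P : pred I) (f : I -> {poly int}) :
  umbral (\sum_(i <- r | P i) f i) = \sum_(i <- r | P i) umbral (f i).
Proof. exact: (big_morph umbral umbralD umbral0). Qed.

Lemma umbral_eq0M p : (forall n, umbral (p * 'X^n) = 0) -> forall q, umbral (p * q) = 0.
Proof.
move=> p0 q; rewrite -[q]coefK poly_def mulr_sumr umbral_sum big1 // => i _.
by rewrite -mul_polyC mulrCA umbralC p0 mulr0.
Qed.

End Functional.

Definition tr_step (s : int * int * int * int * int) :=
  let: (a, b, c, d, e) := s in (b, c, d, e, - (e + c + b + a)).

(* The sum of the nth powers of the roots of X^5 + X^4 + X^2 + X + 1, the
   reciprocal of the polynomial P. *)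
Definition tr (n : nat) : int := (iter n tr_step (5, -1, 1, -4, 1)).1.1.1.1.

Lemma tr_rec n : tr n.+4.+1 = - (tr n.+4 + tr n.+2 + tr n.+1 + tr n).
Proof. by rewrite /tr !iterS; case: (iter n _ _) => [[[[a b] c] d] e]. Qed.

Definition Pint : {poly int} := 1 + 'X + 'X^3 + 'X^4 + 'X^5.
Definition Prec : {poly int} := 'X^5 + 'X^4 + 'X^2 + 'X + 1.

(** Newton's identities: P is the product of the 1 - r X over the roots r of [Prec]. The initial
    values of [tr] settle the degrees up to 5, the recurrence the others. *)
Lemma logder_Pint N : logder N Pint (- \sum_(1 <= n < N.+1) tr n *: 'X^n).
Proof.
set w : {poly int} := - _; move=> n nN.
have wE i : (i <= N)%N -> w`_i
                          = if i is i'.+1 then - tr i else 0.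
  move=> iN; rewrite /w coefN coef_sum; case: i iN => [|i] iN.
    by rewrite big_nat big1 ?oppr0 // => -[|j] // _; rewrite coefZ coefXn mulr0.
  rewrite (bigD1_seq i.+1) ?iota_uniq ?mem_index_iota //= coefZ coefXn eqxx mulr1.
  rewrite big1 ?addr0 // => j ji.
  by rewrite coefZ coefXn eq_sym (negPf ji) mulr0.
have -> : 'X * Pint^`() = 'X + 3%:P * 'X^3 + 4%:P * 'X^4 + 5%:P * 'X^5.
  by rewrite /Pint !derivE; ring.
rewrite /Pint !mulrDl mul1r !coefD !coefCM !coefXnM (coefXM w) !coefXn coefX.
have t1 : tr 1 = -1 by [].
have t2 : tr 2 = 1 by [].
have t3 : tr 3 = -4 by [].
have t4 : tr 4 = 1 by [].
case: n nN => [|[|[|[|[|[|n]]]]]] nN; rewrite /= ?wE ?subSS ?subn0 //=; try lia.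
by rewrite (tr_rec n.+1); lia.
Qed.

Lemma polyC2 : (2 : int)%:P = 2 :> {poly int}.
Proof. exact: (rmorph_nat polyC). Qed.

(** * Congruences modulo [Prec] and an integer *)

Definition eqmod (M : int) (p q : {poly int}) :=
  exists r s, p = q + Prec * r + M%:P * s.

Section Congruence.
Variable M : int.
Implicit Types p q : {poly int}.

Lemma eqmod_refl p : eqmod M p p.
Proof. by exists 0, 0; rewrite !mulr0 !addr0. Qed.

Lemma eqmod_trans q p p' : eqmod M p q -> eqmod M q p' -> eqmod M p p'.
Proof. by move=> [r [s ->]] [r' [s' ->]]; exists (r + r'), (s + s'); ring. Qed.

Lemma eqmodD p q p' q' : eqmod M p q -> eqmod M p' q' -> eqmod M (p + p') (q + q').
Proof. by move=> [r [s ->]] [r' [s' ->]]; exists (r + r'), (s + s'); ring. Qed.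

Lemma eqmodMr p q p' : eqmod M p q -> eqmod M (p * p') (q * p').
Proof. by move=> [r [s ->]]; exists (r * p'), (s * p'); ring. Qed.

Lemma umbral_Prec r : umbral tr (Prec * r) = 0.
Proof.
apply: umbral_eq0M => n; rewrite /Prec !mulrDl -!exprD mul1r !umbralD -exprS !umbralX.
by rewrite ![(_ + n)%N]/= tr_rec; ring.
Qed.

Lemma eqmod_umbral p q : eqmod M p q -> (M %| umbral tr p - umbral tr q)%Z.
Proof.
move=> [r [s ->]]; rewrite !umbralD umbral_Prec umbralC addr0 intz.
by rewrite addrC addKr dvdz_mulr.
Qed.

End Congruence.

(** The cross term carries 2 * 2^j, and the square carries 2^(2j) with 2j >= j + 1 because j > 0. *)
Lemma eqmod_sqr j p q : (0 < j)%N -> eqmod (2 ^+ j) p q -> eqmod (2 ^+ j.+1) (p ^+ 2) (q ^+ 2).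
Proof.
move=> j0 [r [s ->]].
exists (2 * q * r + Prec * r ^+ 2 + 2 * r * (2 ^+ j)%:P * s), (q * s + (2 ^+ j.-1)%:P * s ^+ 2).
have -> : (2 ^+ j.+1)%:P = 2 * (2 ^+ j)%:P :> {poly int}.
  by rewrite exprS polyCM polyC2.
have -> : (2 ^+ j)%:P = 2 * (2 ^+ j.-1)%:P :> {poly int}.
  by rewrite -[in LHS](prednK j0) exprS polyCM polyC2.
ring.
Qed.

Lemma eqmod_le i j p q : (i <= j)%N -> eqmod (2 ^+ j) p q -> eqmod (2 ^+ i) p q.
Proof.
move=> /subnKC <- [r [s ->]]; exists r, ((2 ^+ (j - i))%:P * s).
by rewrite mulrA -polyCM -exprD.
Qed.

(** * Computation in F_2[X] modulo [Prec] *)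

Definition bits := (bool * bool * bool * bool * bool)%type.

Definition bits_poly (s : bits) : {poly int} :=
  let: (a, b, c, d, e) := s in
  a%:R + b%:R * 'X + c%:R * 'X^2 + d%:R * 'X^3 + e%:R * 'X^4.

(** Reduction by X^5 = X^4 + X^2 + X + 1, valid modulo 2; the lowest degree comes first. *)
Definition bits_mulX (s : bits) : bits :=
  let: (a, b, c, d, e) := s in (e, a (+) e, b (+) e, c, d (+) e).

Definition bits_add (s s' : bits) : bits :=
  let: (a, b, c, d, e) := s in let: (a', b', c', d', e') := s' in
  (a (+) a', b (+) b', c (+) c', d (+) d', e (+) e').

Definition bits_exp n := iter n bits_mulX (true, false, false, false, false).

Lemma addb_polyE a b : (a (+) b)%:R = a%:R + b%:R - 2 * a%:R * b%:R :> {poly int}.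
Proof. by case: a b => -[] /=; ring. Qed.

Lemma bits_addP s s' : eqmod 2 (bits_poly s + bits_poly s') (bits_poly (bits_add s s')).
Proof.
case: s => [[[[a b] c] d] e]; case: s' => [[[[a' b'] c'] d'] e'].
exists 0, (a%:R * a'%:R + b%:R * b'%:R * 'X + c%:R * c'%:R * 'X^2
           + d%:R * d'%:R * 'X^3 + e%:R * e'%:R * 'X^4).
rewrite /bits_poly /bits_add !addb_polyE.
by rewrite polyC2; ring.
Qed.

Lemma bits_mulXP s : eqmod 2 ('X * bits_poly s) (bits_poly (bits_mulX s)).
Proof.
case: s => [[[[a b] c] d] e].
exists e%:R, (- e%:R * (1 + (1 - a%:R) * 'X + (1 - b%:R) * 'X^2 + (1 - d%:R) * 'X^4)).
rewrite /bits_poly /bits_mulX !addb_polyE /Prec.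
by rewrite polyC2; ring.
Qed.

Lemma bits_expP n : eqmod 2 'X^n (bits_poly (bits_exp n)).
Proof.
elim: n => [|n IH]; first by exists 0, 0; rewrite /= expr0; ring.
apply: eqmod_trans (bits_mulXP _); rewrite exprSr [X in eqmod _ _ X]mulrC; exact: eqmodMr.
Qed.

(* The roots of Prec modulo 2 generate F_32, hence have order 31. *)
Lemma eqmod_X31 k : eqmod (2 ^+ k.+1) 'X^(31 * 2 ^ k) 1.
Proof.
elim: k => [|k IH].
  apply: eqmod_trans (bits_expP _) _.
  rewrite (_ : bits_exp _ = bits_exp 0); last by vm_compute.
  by exists 0, 0; rewrite /=; ring.
by rewrite expnSr mulnA exprM -[X in eqmod _ _ X](expr1n _ 2); apply: eqmod_sqr.
Qed.

Lemma eqmod_period k n c : (2 ^ k %| c)%N -> eqmod (2 ^+ k.+1) 'X^(n + 31 * c) 'X^n.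
Proof.
move=> /dvdnP[d ->]; elim: d => [|d IH]; first by rewrite muln0 addn0; exact: eqmod_refl.
apply: eqmod_trans IH; rewrite (mulSn d) mulnDr addnCA exprD -[X in eqmod _ _ X]mul1r.
by apply: eqmodMr; exact: eqmod_X31.
Qed.

Definition bits0 : bits := (false, false, false, false, false).

Lemma bits_sumP (e : nat -> nat) l :
  eqmod 2 (\sum_(i <- l) 'X^(e i))
     (bits_poly (foldr (fun r => bits_add (bits_exp r)) bits0 [seq (e i %% 31)%N | i <- l])).
Proof.
elim: l => [|i l IH]; first by rewrite big_nil; exists 0, 0; rewrite /=; ring.
rewrite big_cons [map _ _]/= [foldr _ _ _]/=; apply: eqmod_trans (bits_addP _ _); apply: eqmodD => //.
apply: eqmod_trans (bits_expP _).
rewrite [X in eqmod _ 'X^X _](divn_eq _ 31) addnC mulnC.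
exact: (@eqmod_period 0 _ _ (dvd1n _)).
Qed.

(** * Gaussian periods modulo powers of 2 *)

Definition orbit_sum (a : nat) : {poly int} := \sum_(i < 5) 'X^(2 ^ i * a).

(** In F_32 this is the trace to F_2 of a power of a root, hence 0 or 1; the 31 residues of a are
    checked by computation. *)
Lemma orbit_sum_scalar2 a : exists c : int, eqmod 2 (orbit_sum a) c%:P.
Proof.
pose bs b := foldr (fun r => bits_add (bits_exp r)) bits0
               [seq ((2 ^ i * b) %% 31)%N | i <- iota 0 5].
have chk : all (fun b => bs b \in [:: bits_exp 0; bits0])
              (iota 0 31) by vm_compute.
have H : eqmod 2 (orbit_sum a) (bits_poly (bs (a %% 31)%N)).
  rewrite /orbit_sum -(big_mkord xpredT (fun i => 'X^(2 ^ i * a))) /index_iota subn0 /bs.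
  rewrite (eq_map (fun i => modnMmr _ _ _)).
  exact: (bits_sumP (fun i => 2 ^ i * a)%N).
  have /(allP chk) : (a %% 31)%N \in iota 0 31 by rewrite mem_iota ltn_mod.
  rewrite !inE => /orP[] /eqP bsE; rewrite bsE in H.
    by exists 1; apply: eqmod_trans H _; exists 0, 0; rewrite /=; ring.
  by exists 0; apply: eqmod_trans H _; exists 0, 0; rewrite /=; ring.
Qed.

(** With D = X^a one has D^32 = D to this precision, so the squares of the terms give back the orbit
    sum. The ten products D^(2^i + 2^j) with i < j form the doubling orbits of D^3 and D^5. *)
Lemma orbit_sum_sqr k a : (2 ^ k %| a)%N ->
  eqmod (2 ^+ k.+1) (orbit_sum a ^+ 2)
     (orbit_sum a + 2 * (orbit_sum (3 * a) + orbit_sum (5 * a))).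
Proof.
move=> ka; have [r [s E]] := eqmod_period a ka.
pose D : {poly int} := 'X^a.
have yE n : orbit_sum (n * a) = D ^+ n + D ^+ (2 * n) + D ^+ (4 * n) + D ^+ (8 * n) + D ^+ (16 * n).
  rewrite /orbit_sum !big_ord_recl big_ord0 /= addr0 /bump /= !addrA -!exprM.
  do 5!(congr (_ + _) || (congr ('X^_); lia)).
have {}E : D ^+ 32 - D = Prec * r + (2 ^+ k.+1)%:P * s.
  rewrite -exprM (_ : (a * 32 = a + 31 * a)%N); last by lia.
  by rewrite E /D; ring.
(* The terms of f come from replacing D^32, D^40, D^48 and D^80 by D, D^9, D^17 and D^18. *)
pose f := 1 - 2 * D ^+ 8 - 2 * D ^+ 16 - 2 * D ^+ 16 * (D ^+ 32 + D).
have -> : orbit_sum a ^+ 2 =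
    orbit_sum a + 2 * (orbit_sum (3 * a) + orbit_sum (5 * a)) + (D ^+ 32 - D) * f.
  have := yE 1%N; rewrite mul1n => ->; rewrite !yE /f.
  rewrite ![(_ * 1)%N]/= ; ring.
by rewrite E; exists (r * f), (s * f); ring.
Qed.

(** * Partitions *)

Section Partitions.
Variable A : {pred nat}.

Definition eulerP (N : nat) : {poly int} :=
  \prod_(i < N | i.+1 \in A) (1 - 1 *: 'X^(i.+1)).

(** A size outside [A] keeps only the summand j = 0, so that expanding the product runs over exactly
    the multiplicity functions counted by [npart]. *)
Definition partsP (N : nat) : {poly int} :=
  \prod_(i < N) \sum_(j < N.+1 | (0 < j)%N ==> (i.+1 \in A)) 'X^(j * i.+1).

Lemma npart_coef n : (npart A n)%:R = (partsP n)`_n :> int.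
Proof.
rewrite /partsP.
under eq_bigr do rewrite big_mkcond.
rewrite bigA_distr_bigA coef_sum /npart -sum1_card natr_sum big_mkcond /=.
apply: eq_bigr => f _; rewrite inE.
case: (boolP [forall i, _]) => [/forallP fA|]; last first.
  rewrite andbF => /forallPn[i /negPf fi].
  by rewrite (bigD1 i) //= fi mul0r coef0.
rewrite andbT (eq_bigr (fun i : 'I_n => 'X^(f i * i.+1))); last first.
  by move=> i _; rewrite fA.
by rewrite prodrXr coefXn eq_sym; case: eqP.
Qed.

Lemma eulerP_partsP N : eq_upto N (eulerP N * partsP N) 1.
Proof.
rewrite /eulerP big_mkcond -big_split /=.
apply: (@eq_upto_trans N (\prod_(i < N) 1)); last by rewrite big1_eq.
apply: eq_upto_prod => i _; case: ifP => iA; last first.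
  rewrite mul1r (bigD1 ord0) //= big1 ?addr0 ?mul0n ?expr0 // => j /andP[].
  by rewrite implybF -eqn0Ngt => /eqP j0 /eqP[]; apply: val_inj.
apply: eq_upto_trans (@geomP N 1 i.+1 _) => //; apply: eq_uptoM => //.
have -> : \sum_(j < N.+1 | (0 < j)%N ==> true) 'X^(j * i.+1) = geom N 1 i.+1.
  rewrite /geom; apply: eq_big => [j|j _]; first by rewrite implybT.
  by rewrite expr1n scale1r mulnC.
exact: eq_upto_refl.
Qed.

Lemma eulerP_widen n N : (n <= N)%N -> eq_upto n (eulerP N) (eulerP n).
Proof.
move=> nN; rewrite /eulerP [X in eq_upto _ _ X](big_ord_widen_cond N (fun i => i.+1 \in A)
   (fun i => 1 - 1 *: 'X^(i.+1) : {poly int})) //.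
rewrite big_mkcond [X in eq_upto _ _ X]big_mkcond; apply: eq_upto_prod => i _.
rewrite andbC; case: ltnP => //= ni; case: ifP => // _.
rewrite -[X in eq_upto _ _ X]subr0; apply: eq_uptoD => //; apply: eq_uptoN.
by rewrite scale1r -['X^_]mulr1; apply: eq_upto_Xn.
Qed.

(** Both truncations are inverse to the Euler product up to X^n, and the Euler factors beyond the
    nth are 1 up to X^n. *)
Lemma partsP_coef n N : (n <= N)%N -> (partsP N)`_n = (npart A n)%:R.
Proof.
move=> nN; rewrite npart_coef; suff : eq_upto n (partsP N) (partsP n) by exact.
apply: (@eq_upto_cancel n (eulerP n) (partsP n) _ _ (@eulerP_partsP n)).
apply: (@eq_upto_trans n 1); last exact: (eq_upto_sym (@eulerP_partsP n)).
apply: (@eq_upto_trans n (eulerP N * partsP N)).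
  by apply: eq_uptoM => //; apply: eq_upto_sym; exact: eulerP_widen.
by move=> i i_n; rewrite eulerP_partsP // (leq_trans i_n).
Qed.

Lemma logder_eulerP N : exists2 w, logder N (eulerP N) w &
  forall n, (0 < n <= N)%N -> w`_n = - (sigma A n)%:Z.
Proof.
exists (\sum_(i < N | i.+1 \in A)
  - (\sum_(1 <= j < N.+1) (1 ^+ j *+ i.+1) *: 'X^(i.+1 * j))).
  by apply: logder_prod => i _; exact: logder_geom.
move=> n /andP[n0 nN]; rewrite coef_sum /sigma.
rewrite (eq_bigr (fun i : 'I_N => - (if (i.+1 %| n)%N then i.+1%:Z else 0))); last first.
  move=> i _; rewrite coefN coef_sum; congr (- _).
  case: ifP => [/dvdnP[d nE]|ndv].
    have d1 : (0 < d <= N)%N by nia.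
    rewrite (bigD1_seq d) ?iota_uniq ?mem_index_iota //= big1 ?addr0.
      by rewrite coefZ coefXn nE mulnC eqxx mulr1 expr1n natz.
    move=> j jd; rewrite coefZ coefXn nE mulnC eqn_pmul2l // eq_sym (negPf jd).
    exact: mulr0.
  apply: big1 => j _; rewrite coefZ coefXn; case: eqP => [nE|_]; last exact: mulr0.
  by rewrite nE dvdn_mulr in ndv.
rewrite sumrN; congr (- _).
rewrite -(big_mkord (fun i => i.+1 \in A) (fun i => if (i.+1 %| n)%N then i.+1%:Z else 0)).
rewrite -(big_add1 _ _ 0%N N.+1 (fun i => i \in A) (fun i => if (i %| n)%N then i%:Z else 0)).
rewrite (big_morph Posz PoszD (erefl _)) -big_mkcondr.
rewrite -[RHS]big_filter -[LHS]big_filter; apply: perm_big; apply: uniq_perm.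
- by rewrite filter_uniq ?iota_uniq.
- by rewrite filter_uniq ?divisors_uniq.
move=> d; rewrite !mem_filter mem_index_iota -dvdn_divisors //.
case: (d \in A) => //=; case: (boolP (d %| n)%N) => //= dn; apply/andP.
by split; [exact: dvdn_gt0 dn|rewrite ltnS (leq_trans (dvdn_leq _ dn))].
Qed.

Lemma sigma_tr n v : is_calA A -> (0 < n)%N -> (2 ^ v %| n)%N ->
  (2 ^+ v.+1 %| (sigma A n)%:Z + tr n)%Z.
Proof.
move=> [_ HA] n0 nv; have [w Lw wE] := logder_eulerP n.
have L := logderM Lw (@logder_Pint n).
have Pm i : (i <= n)%N -> (2 %| (Pint - partsP n)`_i)%Z.
  move=> i_n; rewrite coefB partsP_coef //.
  have := congr1 (fun x : 'F_2 => x : nat) (HA i); rewrite /Ppoly /Pint !coefD !coef1 !coefX !coefXn.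
  rewrite -!natrD natz !val_Fp_nat //. move=> E.
  by rewrite -eqz_mod_dvd !natz !modz_nat E.
have q0 : (eulerP n * Pint)`_0 = 1.
  rewrite coefM big_ord_recl big_ord0 /= addr0 (@eulerP_widen 0 n) //.
  by rewrite /eulerP big_ord0 /Pint !coefD !coef1 !coefX !coefXn.
(* [partsP n] inverts [eulerP n] up to X^n and agrees there with P modulo 2, by the defining
   property of [A]. *)
have qe i : (i <= n)%N -> (2 %| (eulerP n * Pint - 1)`_i)%Z.
  move=> i_n; have -> : eulerP n * Pint - 1
     = eulerP n * (Pint - partsP n) + (eulerP n * partsP n - 1) by ring.
  rewrite coefD rpredD //; last by rewrite coefB (@eulerP_partsP n) // subrr.
  rewrite coefM; apply: (big_ind (fun x => 2 %| x)%Z); rewrite ?dvdz0 //.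
    by move=> *; rewrite rpredD.
  by move=> j _; rewrite dvdz_mull // Pm //; have := ltn_ord j; lia.
have := logder_even q0 qe L _ nv; rewrite n0 leqnn => /(_ isT).
rewrite coefD wE ?n0 ?leqnn // coefN coef_sum.
rewrite (bigD1_seq n) ?iota_uniq ?mem_index_iota ?n0 ?ltnSn //= coefZ coefXn eqxx mulr1.
rewrite big1 ?addr0 => [|j jn]; last by rewrite coefZ coefXn eq_sym (negPf jn) mulr0.
by rewrite -opprD rpredN.
Qed.
End Partitions.

(** * The multiplication rule *)

(** Transferred from [sigma] of an actual set [A]: the divisors of 2 n that do not divide n are
    multiples of 2^(k+1), so sigma is unchanged to this precision, and [sigma_tr] turns it into -
    [tr]. *)
Lemma tr_double k n : (2 ^ k %| n)%N -> (2 ^+ k.+1 %| tr (2 * n) - tr n)%Z.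
Proof.
case: (posnP n) => [->|n0 kn]; first by rewrite muln0 subrr dvdz0.
have [A HA _] := calA_exists_unique.
have dv2 : (2 ^ k %| 2 * n)%N by rewrite dvdn_mull.
have s1 := sigma_tr HA n0 kn.
have s2 : (2 ^+ k.+1 %| (sigma A (2 * n))%:Z + tr (2 * n))%Z.
  by apply: sigma_tr => //; rewrite muln_gt0.
have s3 : (2 ^+ k.+1 %| (sigma A (2 * n))%:Z - (sigma A n)%:Z)%Z.
  have [m om nE] : exists2 m, odd m & n = (2 ^ logn 2 n * m)%N.
    exists (n`_(2^'))%N; last by rewrite -p_part partnC.
    by rewrite odd_2'nat part_pnat.
  have le_k : (k <= logn 2 n)%N by rewrite -pfactor_dvdn.
  rewrite pow2_Posz -eqz_mod_dvd !modz_nat {1 2}nE mulnA -expnS.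
  rewrite -(modn_dvdm _ (dvdn_exp2l 2 (le_k : (k.+1 <= (logn 2 n).+1)%N))).
  by rewrite sigma_compatible // modn_dvdm // dvdn_exp2l.
rewrite (_ : _ - _ = ((sigma A (2 * n))%:Z + tr (2 * n)) - ((sigma A n)%:Z + tr n)
   - ((sigma A (2 * n))%:Z - (sigma A n)%:Z)); last by ring.
by rewrite rpredB // rpredB.
Qed.

Lemma tr_pow2 k i n : (2 ^ k %| n)%N -> (2 ^+ k.+1 %| tr (2 ^ i * n) - tr n)%Z.
Proof.
move=> kn; elim: i => [|i IH]; first by rewrite mul1n subrr dvdz0.
rewrite -(subrKA (tr (2 ^ i * n))) rpredD // expnS -mulnA tr_double //.
by rewrite dvdn_mull.
Qed.

Lemma tr_period k n c : (2 ^ k %| c)%N -> (2 ^+ k.+1 %| tr (n + 31 * c) - tr n)%Z.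
Proof. by move=> kc; rewrite -(umbralX tr (n + 31 * c)) -(umbralX tr n); apply/eqmod_umbral/eqmod_period. Qed.

(* By orbit_sum_sqr, scalars modulo 2^j at a, 3a and 5a give a scalar modulo
   2^(j+1) at a. *)
Lemma orbit_sum_scalar k a j : (2 ^ k %| a)%N -> (j <= k)%N ->
  exists c : int, eqmod (2 ^+ j.+1) (orbit_sum a) c%:P.
Proof.
elim: j a => [|j IH] a ka jk; first exact: orbit_sum_scalar2.
have [c Ec] := IH a ka (ltnW jk).
have [c3 E3] := IH (3 * a)%N (dvdn_mull _ ka) (ltnW jk).
have [c5 E5] := IH (5 * a)%N (dvdn_mull _ ka) (ltnW jk).
exists (c ^+ 2 - 2 * (c3 + c5)).
have [r [s Es]] := eqmod_sqr (ltn0Sn j) Ec.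
have [r' [s' Es']] := eqmod_le (jk : (j.+2 <= k.+1)%N) (orbit_sum_sqr ka).
move: E3 E5 => [r3 [s3 E3]] [r5 [s5 E5]].
exists (r - r' - 2 * (r3 + r5)), (s - s' - (s3 + s5)).
have -> : orbit_sum a = orbit_sum a ^+ 2 - 2 * (orbit_sum (3 * a) + orbit_sum (5 * a))
    - Prec * r' - (2 ^+ j.+2)%:P * s' by rewrite Es'; ring.
have -> : (c ^+ 2 - 2 * (c3 + c5))%:P = c%:P ^+ 2 - 2 * (c3%:P + c5%:P).
  by rewrite polyCB polyC_exp (polyCM 2) polyC2 polyCD.
have E2 : (2 ^+ j.+2)%:P = 2 * (2 ^+ j.+1)%:P :> {poly int}.
  by rewrite exprS polyCM polyC2.
by rewrite Es E3 E5 !E2; ring.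
Qed.

(** Traces identify the scalar c: 5 c is the sum of the tr (2^i a), that is 5 tr a modulo 2^(k+1),
    and 5 is odd. *)
Lemma orbit_sum_tr k a : (2 ^ k %| a)%N -> eqmod (2 ^+ k.+1) (orbit_sum a) (tr a)%:P.
Proof.
move=> ka; have [c Ec] := orbit_sum_scalar ka (leqnn k).
suff [d trE] : exists d, c = tr a + 2 ^+ k.+1 * d.
  by apply: eqmod_trans Ec _; exists 0, d%:P; rewrite trE polyCD polyCM; ring.
have := eqmod_umbral Ec; rewrite umbral_sum -[c%:P]mulr1 umbralC -(expr0 'X) umbralX.
under eq_bigr do rewrite umbralX.
rewrite -[tr 0]/5 intz => dvc.
have dvt : (2 ^+ k.+1 %| \sum_(i < 5) tr (2 ^ i * a) - tr a * 5)%Z.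
  rewrite (_ : tr a * 5 = \sum_(i < 5) tr a); last first.
    by rewrite sumr_const card_ord mulr_natr.
  by rewrite -sumrB rpred_sum // => i _; exact: tr_pow2.
have : (2 ^+ k.+1 %| (c - tr a) * 5)%Z.
  by rewrite mulrBl -(subrKA (\sum_(i < 5) tr (2 ^ i * a))) rpredD // -opprB rpredN.
rewrite Gauss_dvdzl; last by rewrite coprimezE abszX coprimeXl.
move=> /dvdzP[d cE]; exists d; rewrite mulrC -cE; ring.
Qed.

Lemma tr_mul k a b : (2 ^ k %| a)%N ->
  (2 ^+ k.+1 %| \sum_(i < 5) tr (2 ^ i * a + b) - tr a * tr b)%Z.
Proof.
move=> /orbit_sum_tr/(@eqmodMr _ _ _ 'X^b)/eqmod_umbral.
rewrite umbralC umbralX intz mulr_suml umbral_sum.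
by under eq_bigr do rewrite -exprD umbralX.
Qed.

(** * 2-adic valuations *)

Lemma Z2_addE (x y : Z2) n : (x + y) n = ((x n + y n) %% 2 ^+ n)%Z.
Proof. by []. Qed.

Lemma Z2_mulE (x y : Z2) n : (x * y) n = ((x n * y n) %% 2 ^+ n)%Z.
Proof. by []. Qed.

Lemma Z2_oppE (x : Z2) n : (- x) n = ((- x n) %% 2 ^+ n)%Z.
Proof. by []. Qed.

Lemma Z2_intE (a : int) n : (a%:~R : Z2) n = (a %% 2 ^+ n)%Z.
Proof.
case: a => a; first exact: natr_compatible.
rewrite NegzE mulrNz Z2_oppE -pmulrn natr_compatible.
by rewrite modzNm.
Qed.

Lemma Z2_pow2E k n : (2 ^+ k : Z2) n = (2 ^+ k %% 2 ^+ n)%Z.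
Proof. by rewrite -Z2_intE rmorphXn. Qed.

(** The quotient is the limit of x (n + k) / 2^k; the index is shifted because dividing by 2^k costs
    k digits. *)
Lemma Z2_res0 (x : Z2) k : x k = 0 -> Z2dvd (2 ^+ k) x.
Proof.
move=> xk; have dv n : (2 ^+ k %| x (n + k)%N)%Z.
  elim: n => [|n IH]; first by rewrite add0n xk dvdz0.
  have /eqP := res_compatible x (n + k).
  rewrite eqz_mod_dvd addSn => /(dvdz_trans (dvdz_exp2l 2 (leq_addl n k))) d.
  by rewrite -(subrK (x (n + k)%N) (x _)) rpredD.
have cy : compatible (fun n => x (n + k)%N %/ 2 ^+ k)%Z.
  move=> n; apply/eqP; rewrite eqz_mod_dvd addSn.
  have nz : (2 ^+ k : int) != 0 by rewrite expf_neq0.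
  rewrite -(dvdz_mul2r nz).
  rewrite mulrBl !divzK -?addSn // -exprD -eqz_mod_dvd; apply/eqP.
  by rewrite -(res_compatible x (n + k)) addSn.
exists (Z2lim cy); apply: Z2_eqP => n; rewrite Z2_mulE Z2_pow2E modzMml.
rewrite (_ : Z2lim cy n = ((x (n + k)%N %/ 2 ^+ k)%Z %% 2 ^+ n)%Z) // modzMmr.
rewrite mulrC divzK //; elim: k {xk dv cy} => [|k IH]; first by rewrite addn0 res_mod.
rewrite IH addnS; apply/eqP; rewrite eqz_mod_dvd.
have /eqP := res_compatible x (n + k); rewrite eq_sym eqz_mod_dvd.
by apply: dvdz_trans; rewrite dvdz_exp2l // leq_addr.
Qed.

Lemma Z2dvd_resP (x : Z2) k : Z2dvd (2 ^+ k) x <-> x k = 0.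
Proof. by split; [exact: Z2dvd_res|exact: Z2_res0]. Qed.

Lemma Z2dvdD d (x y : Z2) : Z2dvd d x -> Z2dvd d y -> Z2dvd d (x + y).
Proof. by move=> [a ->] [b ->]; exists (a + b); rewrite mulrDr. Qed.

Lemma Z2dvdN d (x : Z2) : Z2dvd d x -> Z2dvd d (- x).
Proof. by move=> [a ->]; exists (- a); rewrite mulrN. Qed.

Lemma Z2dvdB d (x y : Z2) : Z2dvd d x -> Z2dvd d y -> Z2dvd d (x - y).
Proof. by move=> dx dy; apply: Z2dvdD => //; apply: Z2dvdN. Qed.

Lemma Z2dvdMl d (x y : Z2) : Z2dvd d x -> Z2dvd d (y * x).
Proof. by move=> [a ->]; exists (y * a); rewrite mulrCA. Qed.

Lemma Z2dvd0 d : Z2dvd d 0.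
Proof. by exists 0; rewrite mulr0. Qed.

Lemma Z2dvd_sum d (I : Type) (r : seq I) (P : pred I) (f : I -> Z2) :
  (forall i, P i -> Z2dvd d (f i)) -> Z2dvd d (\sum_(i <- r | P i) f i).
Proof. by move=> df; apply: (big_ind (Z2dvd d)) => //; [exact: Z2dvd0|exact: Z2dvdD]. Qed.

Lemma Z2dvd_int k (a : int) : Z2dvd (2 ^+ k) a%:~R <-> (2 ^+ k %| a)%Z.
Proof. by rewrite Z2dvd_resP Z2_intE; split=> [/dvdz_mod0P|/dvdz_mod0P]. Qed.

Lemma Z2_eq0 (x : Z2) : (forall k, Z2dvd (2 ^+ k) x) -> x = 0.
Proof.
by move=> dx; apply: Z2_eqP => n; rewrite [RHS]mod0z; apply/Z2dvd_resP.
Qed.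

Lemma Z2lim_dvd u (cu : compatible u) k : Z2dvd (2 ^+ k) (Z2lim cu - (u k)%:~R).
Proof.
apply/Z2dvd_resP; rewrite Z2_addE Z2_oppE Z2_intE modzDmr.
by rewrite (_ : Z2lim cu k = (u k %% 2 ^+ k)%Z) // subrr mod0z.
Qed.

Lemma Z2_reg2 (x : Z2) k : Z2dvd (2 ^+ k.+1) (2 * x) -> Z2dvd (2 ^+ k) x.
Proof.
move=> /Z2dvd_resP; rewrite Z2_mulE (Z2_pow2E 1) modzMml expr1.
move/dvdz_mod0P; rewrite exprS dvdz_mul2l // => /dvdz_mod0P xk.
by apply/Z2dvd_resP; rewrite -resE.
Qed.

Lemma Z2_odd_dvd (a : int) (x : Z2) k : ~~ (2 %| a)%Z ->
  Z2dvd (2 ^+ k) (a%:~R * x) -> Z2dvd (2 ^+ k) x.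
Proof.
move=> a2; have /coprimezP[[u v] /= uv] : coprimez a (2 ^+ k).
  by apply: coprimezXr; rewrite coprimezE coprimen2; move: a2; rewrite dvdzE dvdn2 negbK.
move=> dx; have -> : x = u%:~R * (a%:~R * x) + 2 ^+ k * (v%:~R * x).
  have : (u * a + v * 2 ^+ k)%:~R * x = x by rewrite uv mul1r.
  by rewrite rmorphD !rmorphM rmorphXn => {1}<-; ring.
by apply: Z2dvdD; [exact: Z2dvdMl|exists (v%:~R * x)].
Qed.

Lemma Z2_pow2_dvd (x : Z2) j k : Z2dvd (2 ^+ (j + k)) (2 ^+ j * x) <-> Z2dvd (2 ^+ k) x.
Proof.
split; last by move=> [y ->]; exists y; rewrite exprD mulrA.
elim: j x => [|j IH] x; first by rewrite expr0 mul1r.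
by rewrite addSn (exprS _ j) -mulrA => /Z2_reg2/IH.
Qed.

Lemma Z2_int_reg (a : int) (x : Z2) : a != 0 -> a%:~R * x = 0 -> x = 0.
Proof.
move=> a0; have [e [b [b2 ->]]] : exists e b, ~~ (2 %| b)%Z /\ a = 2 ^+ e * b.
  pose e := logn 2 `|a|; have dv : (2 ^+ e %| a)%Z.
    by rewrite dvdzE abszX pfactor_dvdnn.
  exists e, (a %/ 2 ^+ e)%Z; split; last by rewrite mulrC divzK.
  have : ~~ (2 ^ e.+1 %| `|a|)%N by rewrite pfactor_dvdn ?absz_gt0 // ltnn.
  apply: contraNN; rewrite dvdzE => d2; rewrite (_ : `|a|%N = (`|(a %/ 2 ^+ e)%Z| * 2 ^ e)%N).
    by rewrite expnS dvdn_mul.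
  by rewrite -{1}(divzK dv) abszM abszX.
rewrite rmorphM rmorphXn -mulrA => E0; apply: Z2_eq0 => k.
by apply/(Z2_odd_dvd b2)/(Z2_pow2_dvd _ e); rewrite E0; exact: Z2dvd0.
Qed.

Lemma v2_eq (x y : Z2) :
  (forall k, Z2dvd (2 ^+ k) x <-> Z2dvd (2 ^+ k) y) -> v2 x = v2 y.
Proof.
move=> xy; rewrite /v2 (_ : (x == 0) = (y == 0)); last first.
  by apply/eqP/eqP => [x0|y0]; apply: Z2_eq0 => k; apply/xy; rewrite ?x0 ?y0; exact: Z2dvd0.
case: ifP => // _; congr ((classical_sets.xget _ _)%:Z%:E).
by apply/funext => k; apply/propext; have [a b] := xy k; have [c d] := xy k.+1;
  split=> -[/= u w]; split; auto.
Qed.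

Lemma v2_0 : v2 0 = +oo%E.
Proof. by rewrite /v2 eqxx. Qed.

Lemma v2_ex (x : Z2) : x <> 0 -> exists k : nat, v2 x = k%:Z%:E.
Proof. by rewrite /v2; case: eqP => // _ _; eexists. Qed.

Lemma v2N (x : Z2) : v2 (- x) = v2 x.
Proof. by apply: v2_eq => k; split=> /Z2dvdN; rewrite ?opprK. Qed.

Lemma v2_odd (a : int) (x : Z2) : ~~ (2 %| a)%Z -> v2 (a%:~R * x) = v2 x.
Proof. by move=> a2; apply: v2_eq => k; split; [exact: Z2_odd_dvd|exact: Z2dvdMl]. Qed.

Lemma v2_pow2 (x : Z2) j : v2 (2 ^+ j * x) = ((j%:Z)%:E + v2 x)%E.
Proof.
case: (pselect (x = 0)) => [->|/v2_ex[k vk]]; first by rewrite mulr0 v2_0 addey.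
rewrite vk -EFinD -PoszD; apply/v2P; move/v2P: vk => [d nd].
by rewrite -addnS !Z2_pow2_dvd.
Qed.

(** * The sequence W *)

Lemma W_compatible n : compatible (fun k => - tr (2 ^ k.-1 * n)).
Proof.
case=> [|k]; first by rewrite expr0 !modz1.
apply/eqP; rewrite eqz_mod_dvd /= opprK addrC -opprB rpredN expnS -mulnA.
by apply: tr_double; rewrite dvdn_mulr.
Qed.

(* W n = - Tr(zeta^n) for a 31st root of unity zeta of degree 5 over Q_2. *)
Definition W (n : nat) : Z2 := Z2lim (W_compatible n).

Lemma W_dvd n k : Z2dvd (2 ^+ k.+1) (W n + (tr (2 ^ k * n))%:~R).
Proof. by have := Z2lim_dvd (W_compatible n) k.+1; rewrite rmorphN opprK. Qed.

Lemma Z2_eqS (x y : Z2) : (forall k, Z2dvd (2 ^+ k.+1) (x - y)) -> x = y.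
Proof.
move=> xy; apply/subr0_eq/Z2_eq0 => k; apply: Z2dvdX (xy k); exact: leqnSn.
Qed.

Lemma W_unique n (x : Z2) :
  (forall k, Z2dvd (2 ^+ k.+1) (x + (tr (2 ^ k * n))%:~R)) -> W n = x.
Proof.
move=> xn; apply: Z2_eqS => k.
rewrite (_ : _ - _ = (W n + (tr (2 ^ k * n))%:~R) - (x + (tr (2 ^ k * n))%:~R)).
  by apply: Z2dvdB; [exact: W_dvd|].
by ring.
Qed.

Lemma W_double n : W (2 * n) = W n.
Proof.
apply: W_unique => k.
rewrite (_ : _ + _ = (W n + (tr (2 ^ k * n))%:~R)
   + (tr (2 * (2 ^ k * n)) - tr (2 ^ k * n))%:~R); last first.
  by rewrite mulnCA rmorphB /=; ring.
apply: Z2dvdD; first exact: W_dvd.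
by apply/Z2dvd_int; rewrite tr_double // dvdn_mulr.
Qed.

Lemma W_pow2 i n : W (2 ^ i * n) = W n.
Proof. by elim: i => [|i IH]; rewrite ?mul1n // expnS -mulnA W_double. Qed.

Lemma W_period n c : W (n + 31 * c) = W n.
Proof.
apply: W_unique => k.
rewrite (_ : _ + _ = (W n + (tr (2 ^ k * n))%:~R)
   + (tr (2 ^ k * n + 31 * (2 ^ k * c)) - tr (2 ^ k * n))%:~R); last first.
  by rewrite rmorphB mulnDr (mulnCA 31); ring.
apply: Z2dvdD; first exact: W_dvd.
by apply/Z2dvd_int; rewrite tr_period // dvdn_mulr.
Qed.

Lemma W_mod n : W (n %% 31) = W n.
Proof. by rewrite [in RHS](divn_eq n 31) addnC mulnC W_period. Qed.

Lemma W0 : W 0 = - 5.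
Proof. by apply: W_unique => k; rewrite muln0 addNr; exact: Z2dvd0. Qed.

(** Limit of [tr_mul] taken at 2^k a and 2^k b; the sign arises because [W] is minus a trace. *)
Lemma W_mul a b : \sum_(i < 5) W (2 ^ i * a + b) = - (W a * W b).
Proof.
apply: Z2_eqS => k.
pose t n := (tr (2 ^ k * n))%:~R : Z2.
rewrite (_ : _ - _ = \sum_(i < 5) (W (2 ^ i * a + b) + t (2 ^ i * a + b)%N)
   + (W a * (W b + t b) - (W a + t a) * t b)
   - (\sum_(i < 5) t (2 ^ i * a + b)%N - t a * t b)); last first.
  by rewrite big_split /=; ring.
apply: Z2dvdB; first apply: Z2dvdD.
- by apply: Z2dvd_sum => i _; exact: W_dvd.
- apply: Z2dvdB; first by apply: Z2dvdMl; exact: W_dvd.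
  by rewrite mulrC; apply: Z2dvdMl; exact: W_dvd.
have := @tr_mul k (2 ^ k * a) (2 ^ k * b) (dvdn_mulr _ (dvdnn _)).
move=> /Z2dvd_int; rewrite rmorphB rmorphM rmorph_sum.
by under eq_bigr do rewrite mulnCA -mulnDr.
Qed.

Section WithA.
Variables (A : {pred nat}) (HA : is_calA A).

Lemma W_sigma n : (0 < n)%N ->
  forall k, Z2dvd (2 ^+ k.+1) (W n - (sigma A (2 ^ k * n))%:~R).
Proof.
move=> n0 k.
rewrite (_ : _ - _ = (W n + (tr (2 ^ k * n))%:~R)
    - ((sigma A (2 ^ k * n))%:Z + tr (2 ^ k * n))%:~R); last first.
  by rewrite rmorphD; ring.
apply: Z2dvdB; first exact: W_dvd.
apply/Z2dvd_int; apply: sigma_tr => //; last exact: dvdn_mulr.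
by rewrite muln_gt0 expn_gt0.
Qed.

Lemma U_W j : U_ A j = W (3 ^ j).
Proof.
apply: Z2_eqS => k; rewrite -opprB; apply: Z2dvdN.
rewrite -(subrKA (sigma A (2 ^ k * 3 ^ j))%:~R); apply: Z2dvdD.
  by apply: W_sigma; rewrite expn_gt0.
by rewrite -opprB; apply: Z2dvdN; exact: (Z2lim_dvd _ k.+1).
Qed.

(** Each divisor of 2^k n is 2^i d with i <= k and d a divisor of n, in a unique way; the inner sum
    is then a partial sum of S(d). *)
Lemma sigma_pow2 k n : odd n -> (sigma A (2 ^ k * n))%:Z =
  \sum_(d <- divisors n) d%:Z * \sum_(0 <= i < k.+1) ((2 ^ i * d)%N \in A)%:Z * 2 ^+ i.
Proof.
move=> on; have n0 : (0 < n)%N by case: (n) on.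
have P : perm_eq (divisors (2 ^ k * n))
    [seq (2 ^ i * d)%N | d <- divisors n, i <- index_iota 0 k.+1].
  have odd_div d : (d %| n)%N -> odd d by move=> dn; exact: dvdn_odd dn on.
  apply: uniq_perm; first exact: divisors_uniq.
    apply: allpairs_uniq => [||[d i] [d' i']]; rewrite ?divisors_uniq ?iota_uniq //.
    move=> /allpairsP[[x y] [xn _ [dx iy]]] /allpairsP[[x' y'] [xn' _ [dx' iy']]].
    move: xn xn' dx iy dx' iy' => /= xn xn' -> -> -> ->.
    move=> /= E; have {}E : (2 ^ y * x)%N = (2 ^ y' * x')%N := E.
    move: xn xn'; rewrite -!dvdn_divisors // => /odd_div ox /odd_div ox'.
    have yE : y = y'.
      have := congr1 (logn 2) E; rewrite !lognM ?expn_gt0 ?(odd_gt0 ox) ?(odd_gt0 ox') // !pfactorK //.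
      by rewrite !(@logn_coprime 2) ?coprime2n // !addn0.
    by move/eqP: E; rewrite yE eqn_pmul2l ?expn_gt0 // => /eqP->.
  move=> d; rewrite -dvdn_divisors ?muln_gt0 ?expn_gt0 //.
  apply/idP/allpairsP => [dn|[[x y] /= [xn yk ->]]]; last first.
    rewrite -dvdn_divisors // in xn; rewrite mem_index_iota /= in yk.
    by apply: dvdn_mul => //; apply: dvdn_exp2l.
  have d0 : (0 < d)%N by apply: dvdn_gt0 dn; rewrite muln_gt0 expn_gt0.
  exists (d`_(2^'), logn 2 d)%N; split=> /=; last by rewrite -p_part partnC.
    rewrite -dvdn_divisors // -(@Gauss_dvdr _ (2 ^ k)).
      by apply: dvdn_trans dn; exact: dvdn_part.
    by rewrite coprime_sym coprimeXl // coprime2n odd_2'nat part_pnat.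
  rewrite mem_index_iota /= ltnS.
  have := dvdn_leq_log 2 _ dn; rewrite lognM ?expn_gt0 // pfactorK //.
  rewrite (@logn_coprime 2 n) ?coprime2n // addn0; apply.
  by rewrite muln_gt0 expn_gt0.
rewrite /sigma big_mkcond (perm_big _ P) big_allpairs_dep (big_morph Posz PoszD (erefl _)).
apply: eq_bigr => d _; rewrite (big_morph Posz PoszD (erefl _)) mulr_sumr.
apply: eq_bigr => i _; case: ifP => _; last by rewrite mul0r mulr0.
by rewrite mul1r PoszM mulrC pow2_Posz.
Qed.

Lemma W_S n : odd n -> W n = \sum_(d <- divisors n) d%:R * S_ A d.
Proof.
move=> on; apply: Z2_eqS => k.
rewrite -(subrKA (sigma A (2 ^ k * n))%:~R); apply: Z2dvdD.
  by apply: W_sigma; case: (n) on.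
rewrite sigma_pow2 // rmorph_sum -sumrB; apply: Z2dvd_sum => d _.
rewrite rmorphM /= -pmulrn -mulrBr; apply: Z2dvdMl.
by rewrite -opprB; apply: Z2dvdN; exact: (Z2lim_dvd (@S_compatible A d) k.+1).
Qed.
End WithA.

(** * Linear independence *)

Definition Psi p : {poly int} := \sum_(i < p) 'X^i.

Lemma sum_polyXn (R : nzRingType) p :
  \sum_(i < p) 'X^i = \poly_(i < p) 1 :> {poly R}.
Proof. by rewrite poly_def; under [RHS]eq_bigr do rewrite scale1r. Qed.

Lemma size_sum_polyXn (R : nzRingType) p : size (\sum_(i < p) 'X^i : {poly R}) = p.
Proof. by rewrite sum_polyXn size_poly_eq ?oner_neq0. Qed.

(* The Psi p are irreducible over Q, as the minimal polynomials of roots of unity. *)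
Lemma Psi_bezout p (g : {poly int}) : prime p -> g != 0 -> (size g < p)%N ->
  exists u v (d : int), d != 0 /\ u * Psi p + v * g = d%:P.
Proof.
move=> pr g0 sg; have p1 := prime_gt1 pr.
pose pZtoQ := map_poly (intr : int -> rat).
have [z prim_z] := C_prim_root_exists (prime_gt0 pr).
have [m [mE m_mon mP]] := minCpolyP z.
have size_m : size m = p.
  rewrite -(size_map_poly (ratr : {rmorphism rat -> algC})) -mE.
  by rewrite (minCpoly_cyclotomic prim_z) size_cyclotomic totient_prime // prednK ?prime_gt0.
have PsiQ : pZtoQ (Psi p) = \sum_(i < p) 'X^i.
  by rewrite /pZtoQ rmorph_sum; apply: eq_bigr => i _; rewrite rmorphXn /= map_polyX.
have PsiE : pZtoQ (Psi p) = m.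
  apply/eqP; rewrite eq_sym -eqp_monic //; last first.
    rewrite PsiQ; apply/monicP; rewrite lead_coefE size_sum_polyXn sum_polyXn.
    by rewrite coef_poly prednK ?leqnn ?prime_gt0.
  rewrite -dvdp_size_eqp; first by rewrite size_m PsiQ size_sum_polyXn.
  rewrite -mP PsiQ rootE rmorph_sum /= horner_sum.
  under eq_bigr do rewrite rmorphXn /= map_polyX hornerXn.
  have /eqP := prim_expr_order prim_z; rewrite -subr_eq0 subrX1 mulf_eq0 => /orP[|//].
  rewrite subr_eq0 => /eqP z1.
  by move: prim_z; rewrite z1 => /prim_order_dvd/(_ 1%N); rewrite expr1 eqxx dvdn1 gtn_eqF.
have m_irr (q : {poly rat}) : size q != 1%N -> q %| m -> q %= m.
  move=> q1 qm; rewrite -dvdp_size_eqp //; case/dvdpP: (qm) => r mrq.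
  have m0 := monic_neq0 m_mon.
  have : root (map_poly ratr m) z by rewrite -mE root_minCpoly.
  have [r0 q0] : r != 0 /\ q != 0.
    by move: m0; rewrite mrq mulf_eq0 negb_or => /andP.
  rewrite {1}mrq rmorphM rootM !mP => /orP[mr|mq].
    have := dvdp_leq r0 mr; rewrite mrq size_mul //.
    move: q1 (q0); rewrite -size_poly_gt0; case: (size q) => [|[|n]] // _ _.
    by rewrite addnS /= -[X in (_ <= X)%N]addn0 leq_add2l.
  by rewrite eqn_leq !dvdp_leq.
have cop : coprimep m (pZtoQ g).
  rewrite /coprimep; apply: contraT => /m_irr/(_ (dvdp_gcdl _ _)) E.
  have : m %| pZtoQ g by rewrite -(eqp_dvdl _ E) dvdp_gcdr.
  have gQ0 : pZtoQ g != 0 by rewrite map_poly_eq0_id0 ?intr_eq0 ?lead_coef_eq0.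
  move=> /(dvdp_leq gQ0); rewrite size_m leqNgt.
  by rewrite (leq_ltn_trans (size_poly _ _) sg).
have /Bezout_eq1_coprimepP[[u v] /= uv] := cop.
have [U [a a0 uE]] := rat_poly_scale u; have [V [b b0 vE]] := rat_poly_scale v.
exists (b%:P * U), (a%:P * V), (a * b); split; first by rewrite mulf_neq0.
have inj : injective pZtoQ by apply: map_inj_poly => //; exact: intr_inj.
apply: inj; rewrite /pZtoQ rmorphD !rmorphM /= !map_polyC /= -!/(pZtoQ _) PsiE.
have -> : pZtoQ U = a%:~R *: u by rewrite uE scalerA divff ?scale1r // intr_eq0.
have -> : pZtoQ V = b%:~R *: v by rewrite vE scalerA divff ?scale1r // intr_eq0.
rewrite !mul_polyC scalerA scalerA -!scalerAl (mulrC b%:~R) -scalerDr uv.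
by rewrite alg_polyC polyCM mul_polyC.
Qed.

(** Each new term is reduced modulo M: integers are unary here, and the unreduced values would be
    too large to compute with. *)
Fixpoint tr_mod (M : int) (n : nat) : int * int * int * int * int :=
  if n is n'.+1 then
    let: (a, b, c, d, e) := tr_mod M n' in (b, c, d, e, (- (e + c + b + a) %% M)%Z)
  else (5, -1, 1, -4, 1).

Lemma tr_modP M n : (M %| (tr_mod M n).1.1.1.1 - tr n)%Z.
Proof.
suff : let: (a, b, c, d, e) := tr_mod M n in
  [&& M %| a - tr n, M %| b - tr n.+1, M %| c - tr n.+2, M %| d - tr n.+3
    & M %| e - tr n.+4]%Z by case: tr_mod => [[[[a b] c] d] e] /and5P[].
elim: n => [|n /=]; first by rewrite /= !subrr !dvdz0.
case: (tr_mod M n) => [[[[a b] c] d] e] /and5P[ha hb hc hd he].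
rewrite hb hc hd he /= tr_rec -(subrKA (- (e + c + b + a))) rpredD //.
  by rewrite -eqz_mod_dvd modz_mod.
rewrite (_ : _ - _ = - ((e - tr n.+4) + (c - tr n.+2) + (b - tr n.+1) + (a - tr n))); last by ring.
by rewrite rpredN; exact: (rpredD (rpredD (rpredD he hc) hb) ha).
Qed.

(** Four binary digits are enough, since the largest valuation to be read off among the [E_ i] is 3;
    the index 8 n is 2^3 n. *)
Lemma W_mod16 n : Z2dvd (2 ^+ 4) (W n + ((tr_mod 16 (8 * n)).1.1.1.1)%:~R).
Proof.
rewrite -(subrK (tr (8 * n))  _.1.1.1.1) rmorphD addrCA; apply: Z2dvdD.
  by apply/Z2dvd_int; apply: tr_modP.
exact: (@W_dvd n 3).
Qed.

Lemma W1_neqW0 : W 1 <> W 0.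
Proof.
move=> E; have := W_mod16 1; rewrite E W0 -(mulrNz _ 5) -rmorphD /= => /Z2dvd_int.
by vm_compute.
Qed.

(** A relation yields a polynomial g such that X^n |-> W n kills every multiple of g, by [W_mul]; it
    also kills the multiples of X^31 - 1, by periodicity. If g <> 0, irreducibility of [Psi 31]
    gives a constant d <> 0 in the ideal of [Psi 31] and g. Multiplying by X - 1 yields d (W 1 - W
    0) = 0, which fails modulo 16. *)
Lemma W_free (c : 'I_6 -> int) :
  \sum_(j < 6) (c j)%:~R * W (3 ^ j) = 0 -> forall j, c j = 0.
Proof.
move=> c0.
(* 30 stands for -1 modulo 31: the nonzero residues 2^k 3^j become exponents from 0 to 29, so that g
   has degree below that of [Psi 31]. *)
pose e (j k : nat) := ((2 ^ k * 3 ^ j + 30) %% 31)%N.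
pose g : {poly int} := \sum_(j < 6) \sum_(k < 5) (c j)%:P * 'X^(e j k).
have m6 (i : 'I_6) : val i \in iota 0 6 by rewrite mem_iota /= ltn_ord.
have m5 (i : 'I_5) : val i \in iota 0 5 by rewrite mem_iota /= ltn_ord.
have e_inj (j j' : 'I_6) (k : 'I_5) : e j 0%N = e j' k -> j = j' /\ k = ord0.
  have chk : all (fun j => all (fun j' => all (fun k =>
     (e j 0%N == e j' k) ==> (j == j') && (k == 0%N)) (iota 0 5)) (iota 0 6)) (iota 0 6).
    by vm_compute.
  move/allP: chk => /(_ _ (m6 j))/allP/(_ _ (m6 j'))/allP/(_ _ (m5 k)) /= /implyP chk.
  by move=> /eqP/chk/andP[/eqP jj /eqP kk]; split; apply: val_inj.
have gE (j : 'I_6) : g`_(e j 0%N) = c j.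
  rewrite coef_sum (bigD1 j) //= coef_sum (bigD1 ord0) //= coefCM coefXn eqxx mulr1.
  rewrite !big1 ?addr0 // => [j' jj'|k k0].
    rewrite coef_sum big1 // => k _; rewrite coefCM coefXn.
    by case: eqP => [/e_inj[jj _]|]; [rewrite jj eqxx in jj'|rewrite mulr0].
  rewrite coefCM coefXn; case: eqP => [/e_inj[_ kk]|]; last by rewrite mulr0.
  by rewrite kk eqxx in k0.
suff g0 : g = 0 by move=> j; rewrite -gE g0 coef0.
apply/eqP/negPn/negP => gn0.
have sg : (size g < 31)%N.
  have chk : all (fun j => all (fun k => e j k < 30)%N (iota 0 5)) (iota 0 6) by vm_compute.
  rewrite ltnS; apply: (leq_trans (size_sum _ _ _)); apply/bigmax_leqP => j _.
  apply: (leq_trans (size_sum _ _ _)); apply/bigmax_leqP => k _.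
  rewrite mul_polyC; apply: (leq_trans (size_scale_leq _ _)).
  by rewrite size_polyXn; exact: (allP (allP chk _ (m6 j)) _ (m5 k)).
have Lg p : umbral W (g * p) = 0.
  move: p; apply: umbral_eq0M => b; rewrite mulr_suml umbral_sum.
  rewrite (eq_bigr (fun j : 'I_6 => (c j)%:~R * W (3 ^ j) * - W (b + 30))); last first.
    move=> j _; rewrite mulr_suml umbral_sum.
    under eq_bigr do rewrite -mulrA umbralC -exprD umbralX.
    rewrite -mulr_sumr -mulrA mulrN -W_mul; congr (_ * _); apply: eq_bigr => k _.
    by rewrite -W_mod /e modnDml W_mod -addnA (addnC 30%N).
  by rewrite -mulr_suml c0 mul0r.
have LPsi p : umbral W (Psi 31 * ('X - 1) * p) = 0.
  move: p; apply: umbral_eq0M => b.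
  rewrite (_ : Psi 31 * _ = 'X^31 - 1); last by rewrite mulrC -subrX1.
  by rewrite mulrBl mul1r -exprD umbralB !umbralX addnC (W_period b 1) subrr.
have [u [v [d [d0 uv]]]] := Psi_bezout (isT : prime 31) gn0 sg.
have : umbral W (d%:P * ('X - 1)) = 0.
  rewrite -uv mulrDl [u * _]mulrC mulrAC [v * g]mulrC -(mulrA g).
  by rewrite umbralD Lg LPsi addr0.
rewrite umbralC => /(Z2_int_reg d0).
rewrite -(expr1 'X) -(expr0 'X) umbralB !umbralX => /subr0_eq.
exact: W1_neqW0.
Qed.

(** * Moebius inversion *)

(** For distinct prime divisors [ps] of n this is the sum of mu(d) g(n/d) over the products d of
    members of [ps]. The list is kept explicit so that the prime 31 can be put in front or left
    out. *)
Fixpoint iter_diff (g : nat -> Z2) (ps : seq nat) (n : nat) : Z2 :=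
  if ps is p :: ps' then iter_diff g ps' n - iter_diff g ps' (n %/ p) else g n.

Definition prime_divs (ps : seq nat) (n : nat) :=
  uniq ps && all (fun p => prime p && (p %| n)%N) ps.

Lemma prime_divs_cons p ps n : prime_divs (p :: ps) n ->
  [/\ prime p, (p %| n)%N, prime_divs ps n & prime_divs ps (n %/ p)].
Proof.
move=> /andP[/= /andP[pps ups] /andP[/andP[pp pn] psn]]; split=> //.
  by rewrite /prime_divs ups.
rewrite /prime_divs ups; apply/allP => q qps.
have /andP[pq qn] := allP psn _ qps; rewrite pq /=.
move: qn; rewrite -{1}(divnK pn) Gauss_dvdl //.
rewrite prime_coprime // dvdn_prime2 //.
by apply: contraNneq pps => <-.
Qed.

(** Subtracting the value at n / p removes the terms of the divisors of n / p and leaves the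
    conditions for the other primes intact. *)
Lemma iter_diff_sum (g h : nat -> Z2) ps n :
  (forall n, odd n -> g n = \sum_(d <- divisors n) h d) ->
  odd n -> prime_divs ps n ->
  iter_diff g ps n = \sum_(d <- divisors n | all (fun p => ~~ (d %| n %/ p)%N) ps) h d.
Proof.
move=> gh; elim: ps n => [|p ps IH] n on psn; first by rewrite /= gh.
have [pp pn psn1 psn2] := prime_divs_cons psn.
have n0 : (0 < n)%N by rewrite odd_gt0.
have np0 : (0 < n %/ p)%N by rewrite divn_gt0 ?(prime_gt0 pp) //; exact: dvdn_leq.
have onp : odd (n %/ p) by move: on; rewrite -{1}(divnK pn) oddM => /andP[].
rewrite /= IH // IH // (bigID (fun d => d %| n %/ p)%N) /=.
rewrite [X in X + _ - _](_ : _ = \sum_(d <- divisors (n %/ p) |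
    all (fun q => ~~ (d %| n %/ p %/ q)%N) ps) h d); last first.
  rewrite -[LHS]big_filter -[RHS]big_filter; apply: perm_big; apply: uniq_perm.
  - by rewrite filter_uniq ?divisors_uniq.
  - by rewrite filter_uniq ?divisors_uniq.
  move=> d; rewrite !mem_filter -!dvdn_divisors //.
  case: (boolP (d %| n %/ p)%N) => [dnp|_]; last by rewrite !andbF.
  rewrite !andbT (dvdn_trans dnp) ?dvdn_div // andbT.
  apply: eq_in_all => q qps; congr (~~ _).
  have /andP[pq qnp] := allP (andP psn2).2 _ qps.
  set r := (n %/ p %/ q)%N; have rE : (n %/ p = r * q)%N by rewrite /r divnK.
  have nE : (n %/ q = r * p)%N.
    by rewrite -(divnK pn) rE mulnAC mulnK // prime_gt0.
  have pnq : p != q by apply: contraNneq (andP (andP psn).1).1 => ->.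
  apply/idP/idP => [dnq|]; last by rewrite nE => /dvdn_mulr; apply.
  have : (d %| gcdn (r * q) (r * p))%N by rewrite dvdn_gcd -rE -nE dnp.
  rewrite -muln_gcdr (eqP (_ : coprime q p)) ?muln1 //.
  by rewrite prime_coprime // dvdn_prime2 // eq_sym.
by rewrite addrAC subrr add0r; apply: eq_bigl => d; rewrite andbC.
Qed.

(** A proper divisor d of n divides n / p for any prime p dividing n / d, so only d = n survives. *)
Lemma iter_diff_moebius (g h : nat -> Z2) ps n :
  (forall n, odd n -> g n = \sum_(d <- divisors n) h d) ->
  odd n -> prime_divs ps n -> {subset primes n <= ps} -> iter_diff g ps n = h n.
Proof.
move=> gh on psn sub; rewrite (iter_diff_sum gh) //.
have n0 : (0 < n)%N by rewrite odd_gt0.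
rewrite (big_rem n) -?dvdn_divisors //= [X in if X then _ else _](_ : _ = true); last first.
  apply/allP => p pps; have /andP[pp pn] := allP (andP psn).2 _ pps.
  rewrite gtnNdvd //; last by apply: ltn_Pdiv => //; exact: prime_gt1.
  by rewrite divn_gt0 ?(prime_gt0 pp) //; exact: dvdn_leq.
rewrite big_seq_cond big1 ?addr0 // => d /andP[].
rewrite mem_rem_uniq ?divisors_uniq // inE /= -dvdn_divisors // => /andP[dn dvd] /allP al.
have : ~~ (n %/ d <= 1)%N.
  apply: contra dn => le1; rewrite -(divnK dvd).
  case: (n %/ d)%N le1 (divn_gt0 n (dvdn_gt0 n0 dvd)) => [|[|]] //; last by rewrite mul1n.
  by rewrite (dvdn_leq n0 dvd).
rewrite -ltnNge => gt1; have pp := pdiv_prime gt1; set p := pdiv _ in pp.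
have pnd : (p %| n %/ d)%N by apply: pdiv_dvd.
have pps : p \in ps.
  by apply: sub; rewrite mem_primes pp n0 (dvdn_trans pnd) // dvdn_div.
have := al _ pps; rewrite -(divnK dvd) -{1}(divnK pnd) mulnAC mulnK ?prime_gt0 //.
by rewrite dvdn_mull.
Qed.

Lemma prime_divs_primes n : prime_divs (primes n) n.
Proof.
rewrite /prime_divs primes_uniq; apply/allP => p.
by rewrite mem_primes => /and3P[-> _ ->].
Qed.

(** [ell] is the projection of the units modulo 31 onto their quotient by the powers of 2, cyclic of
    order 6 generated by 3. The table of products is checked by computation. *)
Lemma ell_mul a b : ~~ (31 %| a)%N -> ~~ (31 %| b)%N -> ell (a * b) = ell a + ell b.
Proof.
move=> a31 b31; have ab31 : ~~ (31 %| a * b)%N by rewrite Euclid_dvdM // negb_or a31.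
have [k k4 ak] := (ellP (ell a) a31).1 erefl.
have [k' k'4 bk] := (ellP (ell b) b31).1 erefl.
have vE : nat_of_ord (ell a + ell b) = ((ell a + ell b) %% 6)%N by [].
apply/(ellP _ ab31); rewrite vE.
have chk : all (fun k => all (fun k' => all (fun j => all (fun j' =>
   has (fun l => ((2 ^ k * 3 ^ j %% 31) * (2 ^ k' * 3 ^ j' %% 31)) %% 31
                 == (2 ^ l * 3 ^ ((j + j') %% 6)) %% 31)%N
   (iota 0 5)) (iota 0 6)) (iota 0 6)) (iota 0 5)) (iota 0 5) by vm_compute.
have m6 (i : 'Z_6) : val i \in iota 0 6 by rewrite mem_iota /= (ltn_ord i).
have m5 l : (l <= 4)%N -> l \in iota 0 5 by rewrite mem_iota.
have /hasP[l l4 /eqP E] :=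
  allP (allP (allP (allP chk _ (m5 _ k4)) _ (m5 _ k'4)) _ (m6 (ell a))) _ (m6 (ell b)).
exists l; first by move: l4; rewrite mem_iota.
by rewrite -modnMm ak bk.
Qed.

Lemma ell_div n p : prime p -> (p %| n)%N -> ~~ (31 %| n)%N -> ell (n %/ p) = ell n - ell p.
Proof.
move=> pp pn n31; rewrite -{2}(divnK pn) ell_mul ?addrK //.
  by apply: contra n31 => /dvdn_trans; apply; exact: dvdn_div.
by apply: contra n31 => /dvdn_trans; apply.
Qed.

Fixpoint shift_diff (R : zmodType) (u : 'Z_6 -> R) (ls : seq 'Z_6) (j : 'Z_6) : R :=
  if ls is l :: ls' then shift_diff u ls' j - shift_diff u ls' (j - l) else u j.

Lemma W_ell n : ~~ (31 %| n)%N -> W n = W (3 ^ ell n).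
Proof.
move=> n31; have [k _ E] := (ellP (ell n) n31).1 erefl.
by rewrite -W_mod E W_mod W_pow2.
Qed.

Lemma iter_diff_ell ps n : ~~ (31 %| n)%N -> prime_divs ps n ->
  iter_diff W ps n = shift_diff (fun j => W (3 ^ j)) (map ell ps) (ell n).
Proof.
elim: ps n => [|p ps IH] n n31 psn; first exact: W_ell.
have [pp pn psn1 psn2] := prime_divs_cons psn.
rewrite /= IH // IH //; last by apply: contra n31 => /dvdn_trans; apply; exact: dvdn_div.
by rewrite ell_div.
Qed.

Section WithA.
Variables (A : {pred nat}) (HA : is_calA A).

Lemma S_iter_diff ps n : odd n -> prime_divs ps n -> {subset primes n <= ps} ->
  n%:R * S_ A n = iter_diff W ps n.
Proof.
move=> on psn sub; symmetry.
by apply: (iter_diff_moebius (h := fun d => d%:R * S_ A d) _ on psn sub) => d; exact: W_S.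
Qed.

Lemma S_shift_diff n : odd n -> ~~ (31 %| n)%N ->
  n%:R * S_ A n = shift_diff (fun j => W (3 ^ j)) (map ell (primes n)) (ell n).
Proof.
move=> on n31; rewrite -iter_diff_ell ?prime_divs_primes //.
by apply: S_iter_diff => //; exact: prime_divs_primes.
Qed.

Lemma iter_diff_mult31 ps n : ps != [::] -> 31 \notin ps -> prime_divs ps n ->
  (31 %| n)%N -> iter_diff W ps n = 0.
Proof.
have W31 m : (31 %| m)%N -> W m = W 0 by move=> /eqP m31; rewrite -W_mod m31.
elim: ps n => [|p ps IH] // n _; rewrite inE negb_or eq_sym => /andP[p31 nps] psn n31.
have [pp pn psn1 psn2] := prime_divs_cons psn.
have np31 : (31 %| n %/ p)%N.
  by move: n31; rewrite -{1}(divnK pn) Euclid_dvdM // (@dvdn_prime2 31 p) // eq_sym (negPf p31) orbF.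
case: (eqVneq ps [::]) => [->|psn0] /=; first by rewrite !W31 // subrr.
by rewrite !IH // subrr.
Qed.

(** [W] is constant on multiples of 31, so among the differences for 31 n taken with 31 in front,
    those not dividing by 31 cancel. This needs another prime, whence n <> 1; what remains is minus
    the difference at n. *)
Lemma S_mul31 n : odd n -> n != 1%N -> ~~ (31 %| n)%N ->
  31%:R * S_ A (31 * n) = - S_ A n.
Proof.
move=> on n1 n31; have n0 : (0 < n)%N by rewrite odd_gt0.
have nps : 31 \notin primes n by rewrite mem_primes (negPf n31) !andbF.
have pd : prime_divs (primes n) (31 * n).
  rewrite /prime_divs primes_uniq; apply/allP => p.
  by rewrite mem_primes => /and3P[-> _ pn]; rewrite dvdn_mull.
have E : (31 * n)%:R * S_ A (31 * n) = - (n%:R * S_ A n).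
  rewrite (@S_iter_diff (31 :: primes n)).
  - rewrite /= mulKn // iter_diff_mult31 ?dvdn_mulr // ?sub0r.
      by rewrite -S_iter_diff // ?prime_divs_primes.
    by apply: contra_neq n1 => /eqP; rewrite primes_eq0; case: (n) n0 => [|[|]].
  - by rewrite oddM.
  - by move: pd; rewrite /prime_divs /= nps dvdn_mulr // => /andP[-> ->].
  move=> p; rewrite mem_primes inE => /and3P[pp _].
  rewrite Euclid_dvdM // (@dvdn_prime2 p 31) // => /orP[->//|pn].
  by rewrite mem_primes pp n0 pn orbT.
apply/eqP; rewrite -subr_eq0 opprK; apply/eqP.
apply: (@Z2_int_reg n%:Z); first by case: (n) n0.
by rewrite -pmulrn mulrDr mulrA -natrM (mulnC n) E addNr.
Qed.

Lemma S_31 : S_ A 31 <> 0.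
Proof.
move=> S0; have : 31%:R * S_ A 31 = W 0 - W 1.
  rewrite (@S_iter_diff [:: 31]) //=.
  by rewrite -(W_mod 31).
by rewrite S0 mulr0 => /esym/subr0_eq/esym/W1_neqW0.
Qed.

End WithA.

(** * Character expansion *)

Lemma v_add_mod i c : v_ ((i %% 12)%Z + c) = v_ (i + c).
Proof. by rewrite /v_ modzDml. Qed.

Lemma v_period i : v_ (i + 12) = v_ i.
Proof. by rewrite /v_ modzDr. Qed.

Lemma mod12_ind (P : int -> Prop) :
  (forall r : nat, (r < 12)%N -> P r%:Z) -> forall i, P (i %% 12)%Z.
Proof.
move=> P12 i.
have := modz_ge0 i (isT : 12 != 0 :> int); have := ltz_pmod i (isT : 0 < 12 :> int).
by case: modz => // r r12 _; apply: P12.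
Qed.

Lemma v_half i : v_ i + v_ (i + 6) = 0.
Proof.
rewrite -(addr0 i) -addrA -!(v_add_mod i).
by pattern (i %% 12)%Z; apply: mod12_ind => r; do 12 (case: r => [|r] //).
Qed.

(** The identity 1 - e^(i pi/3) = e^(-i pi/3), a rotation without change of parity or size. *)
Lemma v_third i : v_ (i + 2) + v_ (i - 2) = v_ i.
Proof.
rewrite -(addr0 i) -!addrA -!(v_add_mod i).
by pattern (i %% 12)%Z; apply: mod12_ind => r; do 12 (case: r => [|r] //).
Qed.

Definition v_scale (i : int) : int := if (i %% 2 == 0)%Z then 3 else 1.

(** The identity 1 - e^(2 i pi/3) = sqrt 3 e^(-i pi/6). The shift by one changes the normalisation
    by sqrt 3 as well, so the factor is 3 from an even index and 1 from an odd one. *)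
Lemma v_sixth i : v_ i - v_ (i + 4) = v_scale i * v_ (i - 1).
Proof.
have -> : v_scale i = v_scale (i %% 12)%Z.
  by rewrite /v_scale; have -> : ((i %% 12)%Z %% 2)%Z = (i %% 2)%Z by lia.
rewrite -{1}(addr0 i) -!(v_add_mod i).
by pattern (i %% 12)%Z; apply: mod12_ind => r; do 12 (case: r => [|r] //).
Qed.

Lemma v_pair_neq0 i : ~~ ((v_ i == 0) && (v_ (i + 2) == 0)).
Proof.
rewrite -{1}(addr0 i) -!(v_add_mod i).
by pattern (i %% 12)%Z; apply: mod12_ind => r; do 12 (case: r => [|r] //).
Qed.

Section Vcomb.
Variables (I : finType) (R : comNzRingType) (s : I -> int) (u : I -> R).

(** Covers both [E_], with s j = j, and [F_], with s j = 2 j. *)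
Definition vcomb (i : int) : R := \sum_j (v_ (i + 2 * s j))%:~R * u j.

Lemma vcomb_period i : vcomb (i + 12) = vcomb i.
Proof. by apply: eq_bigr => j _; rewrite addrAC v_period. Qed.

Lemma vcomb_half i : vcomb (i + 6) = - vcomb i.
Proof.
apply/eqP; rewrite -addr_eq0 -big_split big1 //= => j _.
by rewrite -mulrDl -rmorphD addrC addrAC v_half mul0r.
Qed.

Lemma vcomb_third i : vcomb (i + 2) + vcomb (i - 2) = vcomb i.
Proof.
rewrite -big_split; apply: eq_bigr => j _ /=.
by rewrite -mulrDl -rmorphD !(addrAC i _ (2 * s j)) v_third.
Qed.

Lemma vcomb_sixth i : vcomb i - vcomb (i + 4) = (v_scale i)%:~R * vcomb (i - 1).
Proof.
rewrite mulr_sumr -sumrB; apply: eq_bigr => j _ /=.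
rewrite -mulrBl -rmorphB mulrA -rmorphM !(addrAC i _ (2 * s j)) v_sixth.
by rewrite /v_scale; have -> : ((i + 2 * s j) %% 2)%Z = (i %% 2)%Z by lia.
Qed.

Lemma vcomb_sixthN i : vcomb i - vcomb (i - 4) = (v_scale i)%:~R * vcomb (i + 1).
Proof.
have -> : vcomb i = - vcomb (i + 6) by rewrite vcomb_half opprK.
have -> : vcomb (i - 4) = - vcomb (i + 2).
  by rewrite -vcomb_half -[LHS]vcomb_period; congr vcomb; ring.
have := vcomb_sixth (i + 2); have -> : i + 2 + 4 = i + 6 by lia.
have -> : i + 2 - 1 = i + 1 by lia.
rewrite opprK addrC => ->.
by rewrite /v_scale; have -> : ((i + 2) %% 2)%Z = (i %% 2)%Z by lia.
Qed.

(* As v_ i is 2 cos(i pi / 6), divided by sqrt 3 for odd i, this is sqrt(3)^k times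
   the combination of the 2 cos((i + 2 s_j) pi / 6), provided i = k mod 2. *)
Definition vnorm (k : nat) (i : int) : R := 3 ^+ uphalf k * vcomb i.

Lemma uphalf_scale (k : nat) i : (i = k%:Z %[mod 2])%Z ->
  3 ^+ uphalf k * (v_scale i)%:~R = 3 ^+ uphalf k.+1 :> R.
Proof.
move=> ik; have -> : v_scale i = if odd k then 1 else 3.
  by rewrite /v_scale ik modz_nat modn2 eqz_nat; case: odd.
rewrite !uphalf_half /= -(uphalf_half k); case: (boolP (odd k)) => ok /=.
  by rewrite mulr1 uphalf_half ok.
by rewrite uphalf_half (negPf ok) !add0n add1n exprSr.
Qed.

Lemma vnorm_mul (k : nat) i : (i = k%:Z %[mod 2])%Z ->
  vnorm k i - vnorm k (i + 4) = vnorm k.+1 (i - 1).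
Proof. by move=> ik; rewrite /vnorm -mulrBr vcomb_sixth mulrA uphalf_scale. Qed.

Lemma vnorm_mulN (k : nat) i : (i = k%:Z %[mod 2])%Z ->
  vnorm k i - vnorm k (i - 4) = vnorm k.+1 (i + 1).
Proof. by move=> ik; rewrite /vnorm -mulrBr vcomb_sixthN mulrA uphalf_scale. Qed.

Lemma vnorm_period k i : vnorm k (i + 12) = vnorm k i.
Proof. by rewrite /vnorm vcomb_period. Qed.

End Vcomb.

Section Formula.
Variables (R : comNzRingType) (u : 'I_6 -> R).

Definition Gcomb : R := \sum_(j < 6) (-1) ^+ j * u j.

Definition sgn2 (j : int) : R := if (j %% 2 == 0)%Z then 1 else -1.

(* The contributions of the characters of Z/6 of order 6, 3 and 2, for a product
   with n_i factors 1 - x^(-i). *)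
Definition char_sum (n1 n2 n3 n4 n5 : nat) (j : int) : R :=
  2 ^+ n3 * vnorm (fun j : 'I_6 => j%:Z) u (n2 + n4)
    (2 * n5%:Z - 2 * n1%:Z + n4%:Z - n2%:Z - 2 * j)
  + (if n3 == 0%N then vnorm (fun j : 'I_6 => 2 * j%:Z) u (n1 + n5 + n2 + n4)
       (n5%:Z - n1%:Z + n2%:Z - n4%:Z - 4 * j) else 0)
  + (if (n2 + n4 == 0)%N then 2 ^+ (n1 + n5 + n3) * sgn2 j * Gcomb else 0).

Lemma sgn2_odd j l : (l %% 2 = 1)%Z -> sgn2 (j - l) = - sgn2 j.
Proof.
move=> l1; rewrite /sgn2 (_ : ((j - l) %% 2 == 0)%Z = ~~ (j %% 2 == 0)%Z); last by lia.
by case: (_ == _); rewrite /= ?opprK.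
Qed.

Lemma sgn2_even j l : (l %% 2 = 0)%Z -> sgn2 (j - l) = sgn2 j.
Proof. by move=> l1; rewrite /sgn2 (_ : ((j - l) %% 2)%Z = (j %% 2)%Z) //; lia. Qed.

Lemma vnorm_half (I : finType) (s : I -> int) w k i :
  vnorm s w k (i + 6) = - vnorm s w k i :> R.
Proof. by rewrite /vnorm vcomb_half mulrN. Qed.

Lemma vnorm_third (I : finType) (s : I -> int) w k i :
  vnorm s w k (i - 2) = vnorm s w k i - vnorm s w k (i + 2) :> R.
Proof. by rewrite /vnorm -mulrBr -(vcomb_third s w i) addrAC subrr add0r. Qed.

Lemma vnorm_thirdN (I : finType) (s : I -> int) w k i :
  vnorm s w k (i + 2) = vnorm s w k i - vnorm s w k (i - 2) :> R.
Proof. by rewrite vnorm_third subKr. Qed.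

Variables n1 n2 n3 n4 n5 : nat.

Local Notation T := char_sum.

Lemma char_sum_period j : T n1 n2 n3 n4 n5 (j + 6) = T n1 n2 n3 n4 n5 j.
Proof.
rewrite /T; set al := (X in vnorm _ _ _ X); set al' := (X in _ = _ * vnorm _ _ _ X + _ + _).
have -> : al' = al + 12 by rewrite /al /al'; lia.
set a := (X in (if _ then vnorm _ _ _ X else _)).
set a' := (X in _ = _ + (if _ then vnorm _ _ _ X else _) + _).
have -> : a' = a + 12 + 12 by rewrite /a /a'; lia.
by rewrite !vnorm_period -{1}(opprK 6) sgn2_even.
Qed.

(** At the characters of order 6, 3 and 2, the factor 1 - x^(-1) is respectively a rotation, sqrt 3
    times a rotation, and 2. *)
Lemma char_sum1 j : T n1.+1 n2 n3 n4 n5 j = T n1 n2 n3 n4 n5 j - T n1 n2 n3 n4 n5 (j - 1).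
Proof.
rewrite /T; set al := 2 * n5%:Z - 2 * n1%:Z + n4%:Z - n2%:Z - 2 * j.
set a := n5%:Z - n1%:Z + n2%:Z - n4%:Z - 4 * j.
rewrite (_ : _ - 2 * j = al - 2); last by rewrite /al; lia.
rewrite (_ : _ - 2 * (j - 1) = al + 2); last by rewrite /al; lia.
rewrite (_ : _ - 4 * j = a - 1); last by rewrite /a; lia.
rewrite (_ : _ - 4 * (j - 1) = a + 4); last by rewrite /a; lia.
rewrite vnorm_third !addSn -vnorm_mul; last by rewrite /a; lia.
by rewrite sgn2_odd // exprS; case: ifP => _; case: ifP => _; ring.
Qed.

Lemma char_sum5 j : T n1 n2 n3 n4 n5.+1 j = T n1 n2 n3 n4 n5 j - T n1 n2 n3 n4 n5 (j - 5).
Proof.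
rewrite /T; set al := 2 * n5%:Z - 2 * n1%:Z + n4%:Z - n2%:Z - 2 * j.
set a := n5%:Z - n1%:Z + n2%:Z - n4%:Z - 4 * j.
rewrite (_ : _ - 2 * j = al + 2); last by rewrite /al; lia.
rewrite (_ : _ - 2 * (j - 5) = al - 2 + 12); last by rewrite /al; lia.
rewrite (_ : _ - 4 * j = a + 1); last by rewrite /a; lia.
rewrite (_ : _ - 4 * (j - 5) = a - 4 + 12 + 12); last by rewrite /a; lia.
rewrite vnorm_thirdN !addnS !addSn !vnorm_period -vnorm_mulN; last by rewrite /a; lia.
by rewrite sgn2_odd // exprS; case: ifP => _; case: ifP => _; ring.
Qed.

(** Here 1 - x^(-2) is sqrt 3 times a rotation at the orders 6 and 3, and 0 at the order 2. *)
Lemma char_sum2 j : T n1 n2.+1 n3 n4 n5 j = T n1 n2 n3 n4 n5 j - T n1 n2 n3 n4 n5 (j - 2).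
Proof.
rewrite /T; set al := 2 * n5%:Z - 2 * n1%:Z + n4%:Z - n2%:Z - 2 * j.
set a := n5%:Z - n1%:Z + n2%:Z - n4%:Z - 4 * j.
rewrite (_ : _ - 2 * j = al - 1); last by rewrite /al; lia.
rewrite (_ : _ - 2 * (j - 2) = al + 4); last by rewrite /al; lia.
rewrite (_ : _ - 4 * j = a + 1); last by rewrite /a; lia.
rewrite (_ : _ - 4 * (j - 2) = a - 4 + 12); last by rewrite /a; lia.
rewrite !addnS !addSn !vnorm_period -vnorm_mulN; last by rewrite /a; lia.
rewrite -vnorm_mul; last by rewrite /al; lia.
by rewrite sgn2_even //; case: ifP => _; case: ifP => _ //=; ring.
Qed.

Lemma char_sum4 j : T n1 n2 n3 n4.+1 n5 j = T n1 n2 n3 n4 n5 j - T n1 n2 n3 n4 n5 (j - 4).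
Proof.
rewrite /T; set al := 2 * n5%:Z - 2 * n1%:Z + n4%:Z - n2%:Z - 2 * j.
set a := n5%:Z - n1%:Z + n2%:Z - n4%:Z - 4 * j.
rewrite (_ : _ - 2 * j = al + 1); last by rewrite /al; lia.
rewrite (_ : _ - 2 * (j - 4) = al - 4 + 12); last by rewrite /al; lia.
rewrite (_ : _ - 4 * j = a - 1); last by rewrite /a; lia.
rewrite (_ : _ - 4 * (j - 4) = a + 4 + 12); last by rewrite /a; lia.
rewrite !addnS !vnorm_period -vnorm_mulN; last by rewrite /al; lia.
rewrite -vnorm_mul; last by rewrite /a; lia.
by rewrite sgn2_even //; case: ifP => _; case: ifP => _ //=; ring.
Qed.

(** Here 1 - x^(-3) is 2 at the orders 6 and 2, and 0 at the order 3. *)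
Lemma char_sum3 j : T n1 n2 n3.+1 n4 n5 j = T n1 n2 n3 n4 n5 j - T n1 n2 n3 n4 n5 (j - 3).
Proof.
rewrite /T; set al := 2 * n5%:Z - 2 * n1%:Z + n4%:Z - n2%:Z - 2 * j.
set a := n5%:Z - n1%:Z + n2%:Z - n4%:Z - 4 * j.
rewrite (_ : _ - 2 * (j - 3) = al + 6); last by rewrite /al; lia.
rewrite (_ : _ - 4 * (j - 3) = a + 12); last by rewrite /a; lia.
rewrite vnorm_half vnorm_period !addnS !exprS sgn2_odd //.
by case: ifP => _; case: ifP => _ //=; ring.
Qed.

End Formula.

Section ShiftDiff.
Variables (R : comNzRingType) (u : 'Z_6 -> R).

(** Fourier inversion on Z/6: the conjugate pairs of characters of order 6 and 3 give the cosines in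
    [v_], the trivial character gives the plain sum. *)
Lemma char_sum0 (j : 'Z_6) :
  6 * u j = char_sum u 0 0 0 0 0 j%:Z + \sum_i u i.
Proof.
rewrite /char_sum /= /vnorm /= !mul1r !mulr0 !subr0 !sub0r /vcomb /Gcomb.
rewrite mulr_sumr -!big_split /=.
have chk : all (fun j => all (fun i => v_ (- (2 * j%:Z) + 2 * i%:Z)
    + v_ (- (4 * j%:Z) + 2 * (2 * i%:Z)) + (if (j%:Z %% 2 == 0)%Z then 1 else -1) * (-1) ^+ i + 1
    == if i == j then 6 else 0) (iota 0 6)) (iota 0 6) by vm_compute.
have m6 (i : 'Z_6) : val i \in iota 0 6 by rewrite mem_iota /= (ltn_ord i).
rewrite (eq_bigr (fun i : 'I_6 => (if i == j then 6 else 0) * u i)); last first.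
  move=> i _; have /eqP := allP (allP chk _ (m6 j)) _ (m6 i).
  move=> /(congr1 (fun x : int => x%:~R * u i)).
  have -> : (if i == j then 6 else 0 : int)%:~R = (if i == j then 6 else 0) :> R.
    by case: eqP.
  move=> <-; rewrite !rmorphD rmorphM rmorphXn rmorphN1 /sgn2 /=.
  by case: ifP => _; rewrite ?rmorphN1; ring.
rewrite (bigD1 j) //= eqxx big1 ?addr0 // => i /negPf ->.
exact: mul0r.
Qed.

Lemma shift_diff_formula (ls : seq 'Z_6) (j : 'Z_6) : 0 \notin ls ->
  6 * shift_diff u ls j = char_sum u (count_mem 1 ls) (count_mem 2 ls) (count_mem 3 ls)
     (count_mem 4 ls) (count_mem 5 ls) j%:Z + (if ls is [::] then \sum_i u i else 0).
Proof.
elim: ls j => [|l ls IH] j; first by move=> _; exact: char_sum0.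
rewrite inE negb_or => /andP[l0 ls0] /=.
rewrite mulrBr !IH // addr0 opprD addrACA subrr addr0.
have -> : char_sum u (count_mem 1 ls) (count_mem 2 ls) (count_mem 3 ls)
     (count_mem 4 ls) (count_mem 5 ls) (j - l)%R%:Z
   = char_sum u (count_mem 1 ls) (count_mem 2 ls) (count_mem 3 ls)
     (count_mem 4 ls) (count_mem 5 ls) (j%:Z - l%:Z).
  have [->//|->] : (j - l)%R%:Z = j%:Z - l%:Z \/ (j - l)%R%:Z = j%:Z - l%:Z + 6.
    have : (j - l)%R = ((j + (6 - l) %% 6) %% 6)%N :> nat by [].
    have j6 : (j < 6)%N := ltn_ord j; have l6 : (l < 6)%N := ltn_ord l.
    move=> ->; lia.
  exact: char_sum_period.
case: l l0 => -[|[|[|[|[|[|//]]]]]] // l6 _; rewrite ![(_ == _ : nat)]/= !add0n ?add1n.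
- by rewrite -char_sum1.
- by rewrite -char_sum2.
- by rewrite -char_sum3.
- by rewrite -char_sum4.
- by rewrite -char_sum5.
Qed.
End ShiftDiff.

(** * The theorem *)

Lemma v2_near (x : Z2) (a : int) k n : (k < n)%N -> Z2dvd (2 ^+ n) (x - a%:~R) ->
  (2 ^+ k %| a)%Z -> ~~ (2 ^+ k.+1 %| a)%Z -> v2 x = (k%:Z)%:E.
Proof.
move=> kn dx da nda; apply/v2P; split.
  by rewrite -(subrK a%:~R x); apply: Z2dvdD; [exact: Z2dvdX (ltnW kn) dx|exact/Z2dvd_int].
move=> d; move/negP: nda; apply; apply/Z2dvd_int.
by rewrite -(subKr x a%:~R); apply: Z2dvdB => //; exact: Z2dvdX kn dx.
Qed.

Lemma v2_dvd (x : Z2) (k : nat) : ((k%:Z)%:E <= v2 x)%E -> Z2dvd (2 ^+ k) x.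
Proof.
case: (pselect (x = 0)) => [->|/v2_ex[l vl]]; first by move=> _; exact: Z2dvd0.
by rewrite vl lee_fin => kl; apply: (Z2dvdX kl); have [] := (v2P x l).1 vl.
Qed.

Lemma v2_add_lt (x y : Z2) : (v2 x < v2 y)%E -> v2 (x + y) = v2 x.
Proof.
case: (pselect (x = 0)) => [->|/v2_ex[k vk]]; first by rewrite v2_0 ltNge leey.
rewrite vk => lt; have dy : Z2dvd (2 ^+ k.+1) y.
  apply: v2_dvd; move: lt; case: (pselect (y = 0)) => [->|/v2_ex[l ->]].
    by rewrite v2_0 leey.
  by rewrite lte_fin lee_fin.
have [dx ndx] := (v2P x k).1 vk; apply/v2P; split.
  by apply: Z2dvdD => //; apply: Z2dvdX dy.
by move=> d; apply: ndx; rewrite -(addrK y x); apply: Z2dvdB.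
Qed.

Lemma ceil_half n : Num.ceil (n%:R / 2 - 1 : rat) = (uphalf n)%:Z - 1.
Proof.
have nE : n%:R = 2 * (uphalf n)%:R - (odd n)%:R :> rat.
  by rewrite -(natrM _ 2) mul2n -[in LHS](odd_double_half n) uphalf_half doubleD !natrD -!muln2 !natrM; case: odd; lra.
apply: ceil_def; rewrite !rmorphB !rmorph1 /= -pmulrn nE; move: ((uphalf n)%:R : rat) => h.
by case: (odd n); rewrite /= ?mulr1n ?mulr0n; apply/andP; split; lra.
Qed.

Section Values.
Variables (A : {pred nat}) (HA : is_calA A).

Definition uW (j : 'I_6) : Z2 := W (3 ^ j).

Lemma E_vcomb i : E_ A i = vcomb (fun j : 'I_6 => j%:Z) uW i.
Proof. by apply: eq_bigr => j _; rewrite U_W. Qed.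

Lemma F_vcomb i : F_ A i = vcomb (fun j : 'I_6 => 2 * j%:Z) uW i.
Proof. by apply: eq_bigr => j _; rewrite U_W // mulrA. Qed.

Lemma G_comb : G_ A = Gcomb uW.
Proof. by apply: eq_bigr => j _; rewrite U_W. Qed.

Definition u16 (j : nat) : int := - (tr_mod 16 (8 * (3 ^ j %% 31)%N)).1.1.1.1.

Lemma uW_mod16 j : Z2dvd (2 ^+ 4) (uW j - (u16 j)%:~R).
Proof. by rewrite /uW -W_mod /u16 rmorphN opprK; exact: W_mod16. Qed.

Lemma uW_comb_mod16 (c : nat -> int) :
  Z2dvd (2 ^+ 4) (\sum_(j < 6) (c j)%:~R * uW j - (\sum_(j <- iota 0 6) c j * u16 j)%:~R).
Proof.
rewrite -[iota 0 6]/(index_iota 0 6) big_mkord rmorph_sum -sumrB.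
apply: Z2dvd_sum => j _; rewrite rmorphM -mulrBr; apply: Z2dvdMl.
exact: uW_mod16.
Qed.

Lemma v2_E_mod6 i : v2 (E_ A i) = v2 (E_ A (i %% 6)%Z).
Proof.
have add6 x : v2 (E_ A (x + 6)) = v2 (E_ A x) by rewrite !E_vcomb vcomb_half v2N.
have addn (x : int) (n : nat) : v2 (E_ A (x + 6 * n%:Z)) = v2 (E_ A x).
  elim: n => [|n IH]; first by rewrite mulr0 addr0.
  by rewrite -IH -[RHS]add6; congr (v2 (E_ A _)); lia.
rewrite {1}(divz_eq i 6); case: (i %/ 6)%Z => n.
  by rewrite addrC mulrC addn.
by rewrite NegzE -(addn (- _ * _ + _) n.+1); congr (v2 (E_ A _)); ring.
Qed.

Lemma v2_E i : v2 (E_ A i) = ((nth 0%N [:: 0; 0; 1; 0; 0; 3]%N `|(i %% 6)%Z|)%:Z)%:E.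
Proof.
rewrite v2_E_mod6.
have := modz_ge0 i (isT : 6 != 0 :> int); have := ltz_pmod i (isT : 0 < 6 :> int).
case: modz => // r r6 _; rewrite E_vcomb [`|_|%N]/=.
apply: (v2_near (n := 4) _ (uW_comb_mod16 (fun j => v_ (r%:Z + 2 * j%:Z)))).
- by case: r r6 => [|[|[|[|[|[|r]]]]]].
- by case: r r6 => [|[|[|[|[|[|r]]]]]] //; rewrite unlock; vm_compute.
- by case: r r6 => [|[|[|[|[|[|r]]]]]] //; rewrite unlock; vm_compute.
Qed.

Lemma v2_G : v2 (G_ A) = 0%:E.
Proof.
rewrite G_comb; have := uW_comb_mod16 (fun j => (-1) ^+ j).
rewrite (eq_bigr (fun j : 'I_6 => (-1) ^+ j * uW j)) => [dG|j _]; last first.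
  by rewrite rmorphXn rmorphN1.
by apply: (v2_near (n := 4) _ dG) => //; rewrite unlock; vm_compute.
Qed.

(** By [W_free] all six coefficients would vanish. Shifting the index by 3 fixes the part of order 3
    and negates the other two, so differences eliminate Y. The three equations left force X v_(al) =
    X v_(al + 2) = 0, although X <> 0 and these two values of [v_] are never both zero. *)
Lemma char_sum_neq0 n1 n2 n3 n4 n5 j : char_sum uW n1 n2 n3 n4 n5 j <> 0.
Proof.
rewrite /char_sum; set al := _ - 2 * j; set a := _ - 4 * j.
set X := 2 ^+ n3 * 3 ^+ uphalf (n2 + n4) : int.
set Y := (if n3 == 0%N then 3 ^+ uphalf (n1 + n5 + n2 + n4) else 0) : int.
set Z := (if (n2 + n4 == 0)%N then 2 ^+ (n1 + n5 + n3) * (if (j %% 2 == 0)%Z then 1 else -1) else 0) : int.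
pose c (i : 'I_6) := X * v_ (al + 2 * i%:Z) + Y * v_ (a + 2 * (2 * i%:Z)) + Z * (-1) ^+ i.
move=> T0; have c0 : \sum_(i < 6) (c i)%:~R * W (3 ^ i) = 0.
  rewrite -[RHS]T0 /vnorm /vcomb /Gcomb -/uW !mulr_sumr.
  have -> : forall (b : bool) (s : Z2), (if b then s else 0) = b%:R * s.
    by move=> [] s; rewrite ?mul1r ?mul0r.
  have -> : forall (b : bool) (s : Z2), (if b then s else 0) = b%:R * s.
    by move=> [] s; rewrite ?mul1r ?mul0r.
  rewrite !mulr_sumr -!big_split; apply: eq_bigr => i _ /=.
  rewrite /c !rmorphD !rmorphM !rmorphXn /= /uW.
  rewrite /Y /Z /sgn2.
  case: (n3 == 0%N); case: (n2 + n4 == 0)%N; case: (j %% 2 == 0)%Z;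
    rewrite ?rmorphM ?rmorphXn ?rmorphN1 ?rmorph0 ?rmorph1 /=; ring.
have cE := W_free c0.
have X0 : X != 0 by rewrite /X mulf_neq0 // expf_neq0.
have vE : v_ (al + 4) = v_ (al + 2) - v_ al.
  have := v_third (al + 2); rewrite addrK => <-.
  by rewrite addrK; congr v_; lia.
have vN (x : int) : v_ (x + 6) = - v_ x by apply/eqP; rewrite -addr_eq0 addrC v_half.
have E0 := cE (Ordinal (isT : (0 < 6)%N)); have E1 := cE (Ordinal (isT : (1 < 6)%N)).
have E2 := cE (Ordinal (isT : (2 < 6)%N)); have E3 := cE (Ordinal (isT : (3 < 6)%N)).
have E4 := cE (Ordinal (isT : (4 < 6)%N)); have E5 := cE (Ordinal (isT : (5 < 6)%N)).
move: E0 E1 E2 E3 E4 E5; rewrite /c /=.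
have -> : al + 2 * 3 = al + 6 by lia.
have -> : al + 2 * 4 = al + 2 * 1 + 6 by lia.
have -> : al + 2 * 5 = al + 2 * 2 + 6 by lia.
have -> : a + 2 * (2 * 3) = a + 12 by lia.
have -> : a + 2 * (2 * 4) = a + 2 * (2 * 1) + 12 by lia.
have -> : a + 2 * (2 * 5) = a + 2 * (2 * 2) + 12 by lia.
rewrite !vN !v_period !mulr0 !addr0 (_ : 2 * 2 = 4) // (_ : 2 * 1 = 2) // vE => E0 E1 E2 E3 E4 E5.
have /eqP : X * v_ al = 0 by lra.
have /eqP : X * v_ (al + 2) = 0 by lra.
rewrite !(mulf_eq0 X) (negPf X0) /= => v2 v0.
by have := v_pair_neq0 al; rewrite v0 v2.
Qed.

Section Main.
Variable m : nat.
Hypotheses (m_odd : odd m) (m_neq1 : m <> 1%N).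
Hypothesis m_P0 : forall p : nat, p \in calP 0 -> ~~ (p %| m)%N.
Hypothesis m31 : ~~ (31 %| m)%N.

Lemma prime_div_calP p j : p \in primes m -> (p \in calP j) = (ell p == j).
Proof.
rewrite mem_primes => /and3P[pp _ pm]; rewrite inE pp (dvdn_odd pm m_odd) /=.
by case: eqP => // p31; have {}p31 : p = 31%N := p31; move: m31; rewrite -p31 pm.
Qed.

Lemma omega_count j : omega j m = count_mem j (map ell (primes m)).
Proof. by rewrite count_map; apply: eq_in_count => p; exact: prime_div_calP. Qed.

Local Notation w1 := (omega 1 m).
Local Notation w2 := (omega 2 m).
Local Notation w3 := (omega 3 m).
Local Notation w4 := (omega 4 m).
Local Notation w5 := (omega 5 m).

Lemma S_char_sum : 6 * (m%:R * S_ A m) = char_sum uW w1 w2 w3 w4 w5 (ell m)%:Z.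
Proof.
rewrite S_shift_diff // shift_diff_formula; last first.
  apply/mapP => -[p pm /esym p0]; have := @m_P0 p.
  rewrite prime_div_calP // p0 eqxx => /(_ isT).
  by move: pm; rewrite mem_primes => /and3P[_ _ ->].
(* As m <> 1 has a prime divisor, the trivial character contributes nothing. *)
rewrite !omega_count; case E: (primes m) => [|p ps]; last by rewrite addr0.
have /eqP := E; rewrite primes_eq0; case: (m) m_odd m_neq1 => [|[|]] //.
Qed.

Lemma S_neq0_coprime31 : S_ A m <> 0.
Proof.
by move=> S0; apply: (@char_sum_neq0 w1 w2 w3 w4 w5 (ell m)%:Z); rewrite -S_char_sum S0 !mulr0.
Qed.

(** 6 m is twice an odd number: this is the source of the -1 in the formulas. *)
Lemma gamma_char_sum :
  gamma A m = ((-1)%:E + v2 (char_sum uW w1 w2 w3 w4 w5 (ell m)%:Z))%E.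
Proof.
rewrite -S_char_sum (_ : 6 * _ = 2 ^+ 1 * ((3 * m%:Z)%:~R * S_ A m)); last first.
  by rewrite intrM -(pmulrn _ m); ring.
rewrite v2_pow2 v2_odd /gamma; last first.
  by rewrite dvdzE abszM dvdn2 oddM /= m_odd.
have [k ->] := v2_ex S_neq0_coprime31; rewrite -!EFinD; congr EFin; lia.
Qed.

Lemma E_alpha' : E_ A (alpha' m) =
  vcomb (fun j : 'I_6 => j%:Z) uW (2 * w5%:Z - 2 * w1%:Z + w4%:Z - w2%:Z - 2 * (ell m : nat)%:Z).
Proof.
by rewrite /alpha' E_vcomb; apply: eq_bigr => j _; rewrite v_add_mod.
Qed.

Lemma F_a' : F_ A (a' m) =
  vcomb (fun j : 'I_6 => 2 * j%:Z) uW (w5%:Z - w1%:Z + w2%:Z - w4%:Z - 4 * (ell m : nat)%:Z).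
Proof.
by rewrite /a' F_vcomb; apply: eq_bigr => j _; rewrite v_add_mod.
Qed.

Lemma v2_pow3 (x : Z2) n : v2 (3 ^+ n * x) = v2 x.
Proof.
have -> : (3 ^+ n : Z2) = (3 ^+ n)%:~R by rewrite rmorphXn.
apply: v2_odd; rewrite dvdzE abszX dvdn2 oddX negbK; exact: orbT.
Qed.

(** [char_sum] carries 3 to each of the two powers [uphalf]; dividing by the smaller one, a 2-adic
    unit, leaves 3^t. *)
Lemma uphalf_t : uphalf (w1 + w5 + w2 + w4) = (uphalf (w2 + w4) + t_ m)%N.
Proof.
rewrite /t_ /tz !ceil_half.
have : (uphalf (w2 + w4) <= uphalf (w1 + w5 + w2 + w4))%N by apply: uphalf_leq; lia.
lia.
Qed.

Lemma sgn2_ell : sgn2 Z2 (ell m : nat)%:Z = (-1) ^+ ell m.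
Proof. by rewrite /sgn2 modz_nat modn2 eqz_nat -signr_odd; case: odd. Qed.

Lemma gamma_i : w3 <> 0%N -> (w2 + w4 <> 0)%N ->
  gamma A m = ((-1)%:E + ((w3%:Z)%:E + v2 (E_ A (alpha' m))))%E.
Proof.
move=> /eqP/negPf w30 /eqP/negPf w240; rewrite gamma_char_sum /char_sum w30 w240 !addr0.
by rewrite v2_pow2 v2_pow3 E_alpha'.
Qed.

(** Adding 6 to the index negates [E_], so passing from alpha' to alpha'' turns the sign (-1)^ell of
    G into a global sign, which the valuation ignores. *)
Lemma gamma_ii : (w2 + w4 = 0)%N -> (1 <= w3)%N ->
  gamma A m = ((-1)%:E + ((w3%:Z)%:E + v2 (E_ A (alpha'' m) + 2 ^+ (w1 + w5) * G_ A)%R))%E.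
Proof.
move=> w240 w31; rewrite gamma_char_sum /char_sum w240 eqxx gtn_eqF // addr0.
rewrite /vnorm -E_alpha' mul1r exprD sgn2_ell -G_comb.
rewrite (_ : _ + _ = 2 ^+ w3 * (E_ A (alpha' m) + 2 ^+ (w1 + w5) * (-1) ^+ ell m * G_ A)); last by ring.
rewrite v2_pow2; congr (_ + (_ + _))%E.
have E2 n : E_ A (alpha' m + 6 * (2 * n%:Z)) = E_ A (alpha' m).
  elim: n => [|n IH]; first by rewrite !mulr0 addr0.
  rewrite -[RHS]IH !E_vcomb -[RHS]vcomb_period; congr vcomb; lia.
have -> : E_ A (alpha'' m) = E_ A (alpha' m + 6 * (ell m : nat)%:Z).
  by rewrite /alpha''; apply: eq_bigr => j _; rewrite v_add_mod.
rewrite -signr_odd -[in E_ A (_ + _)](odd_double_half (ell m)).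
case: (odd (ell m)); rewrite -mul2n PoszD PoszM mulrDr; last first.
  by rewrite mulr0 add0r E2 mulr1.
rewrite mulr1 (addrC (6 : int)) addrA !E_vcomb vcomb_half -!E_vcomb E2.
by rewrite -v2N; congr v2; rewrite expr1; ring.
Qed.

Lemma gamma_iii : w3 = 0%N -> (w2 + w4 <> 0)%N ->
  gamma A m = ((-1)%:E + v2 (E_ A (alpha' m) + 3 ^+ t_ m * F_ A (a' m))%R)%E.
Proof.
move=> w30 /eqP/negPf w240; rewrite gamma_char_sum /char_sum w30 eqxx mul1r w240 addr0.
by rewrite /vnorm -E_alpha' -F_a' uphalf_t exprD -mulrA -mulrDr v2_pow3.
Qed.

Lemma gamma_iv : w3 = 0%N -> w2 = 0%N -> w4 = 0%N ->
  gamma A m = ((-1)%:E + v2 (E_ A (alpha' m) + 3 ^+ t_ m * F_ A (a' m)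
                 + 2 ^+ (w1 + w5)%N * (-1) ^+ ell m * G_ A)%R)%E.
Proof.
move=> w30 w20 w40; have w240 : (w2 + w4 = 0)%N by rewrite w20 w40.
rewrite gamma_char_sum /char_sum /vnorm uphalf_t w240 w30 eqxx addn0 add0n !mul1r.
by rewrite -E_alpha' -F_a' sgn2_ell -G_comb.
Qed.

End Main.

Lemma S_neq0 m : odd m -> m <> 1%N ->
  (forall p : nat, p \in calP 0 -> ~~ (p %| m)%N) -> ~~ (31 ^ 2 %| m)%N -> S_ A m <> 0.
Proof.
move=> om m1 mP m312; case: (boolP (31 %| m)%N) => [/dvdnP[n mE]|]; last exact: S_neq0_coprime31.
have on : odd n by move: om; rewrite mE oddM => /andP[].
have n31 : ~~ (31 %| n)%N.
  by apply: contra m312 => n31; rewrite mE expnS expn1 dvdn_mul.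
case: (eqVneq n 1%N) => [n1|n1]; first by rewrite mE n1 mul1n; exact: S_31.
move=> S0; apply: (S_neq0_coprime31 on _ _ n31); first exact/eqP.
  by move=> p /mP; apply: contra => pn; rewrite mE dvdn_mulr.
by rewrite -[S_ A n]opprK -S_mul31 // mulnC -mE S0 mulr0 oppr0.
Qed.

End Values.

Theorem theorem2 (A : {pred nat}) (HA : is_calA A) (m : nat)
  (m_odd : odd m) (m_neq1 : m <> 1%N)
  (m_P0 : forall p : nat, p \in calP 0 -> ~~ (p %| m)%N)
  (m_31 : ~~ (31 ^ 2 %| m)%N) :
  [/\ S_ A m <> 0,
      (~~ (31 %| m)%N -> gamma A (31 * m) = gamma A m)
    & coprime m 31 ->
      [/\ (* (i) *)
          omega 3 m <> 0%N -> (omega 2 m + omega 4 m <> 0)%N ->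
          [/\ (alpha' m %% 6)%Z \in [:: 0; 1; 3; 4] ->
                gamma A m = ((omega 3 m)%:Z - 1)%:E%E,
              (alpha' m = 2 %[mod 6])%Z ->
                gamma A m = ((omega 3 m)%:Z)%:E%E
            & (alpha' m = 5 %[mod 6])%Z ->
                gamma A m = ((omega 3 m)%:Z + 2)%:E%E],
          (* (ii) *)
          (omega 2 m + omega 4 m = 0)%N -> (1 <= omega 3 m)%N ->
          [/\ (((omega 1 m + omega 5 m)%N%:Z)%:E < v2 (E_ A (alpha'' m)))%E ->
                gamma A m =
                  ((omega 3 m)%:Z - 1 + (omega 1 m + omega 5 m)%N%:Z)%:E%E,
              (((omega 1 m + omega 5 m)%N%:Z)%:E = v2 (E_ A (alpha'' m)))%E ->
                gamma A m =
                  (((omega 3 m)%:Z - 1)%:E + delta A (alpha'' m))%E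
            & (v2 (E_ A (alpha'' m)) < ((omega 1 m + omega 5 m)%N%:Z)%:E)%E ->
                gamma A m =
                  (((omega 3 m)%:Z - 1)%:E + v2 (E_ A (alpha'' m)))%E],
          (* (iii) *)
          omega 3 m = 0%N -> (omega 2 m + omega 4 m <> 0)%N ->
            gamma A m =
              ((-1)%:E + v2 (E_ A (alpha' m) + 3 ^+ t_ m * F_ A (a' m))%R)%E
        & (* (iv) *)
          omega 3 m = 0%N -> omega 2 m = 0%N -> omega 4 m = 0%N ->
          (omega 1 m + omega 5 m <> 0)%N ->
            gamma A m =
              ((-1)%:E + v2 (E_ A (alpha' m) + 3 ^+ t_ m * F_ A (a' m)
                 + 2 ^+ (omega 1 m + omega 5 m)%N * (-1) ^+ ell m * G_ A)%R)%E]].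
Proof.
split; first exact: S_neq0.
  move=> m31; rewrite /gamma -[RHS]v2N -(S_mul31 HA) //; last exact/eqP.
  by rewrite (pmulrn _ 31) v2_odd.
rewrite coprime_sym prime_coprime // => m31.
split.
- move=> w30 w240.
  have -> := gamma_i HA m_odd m_neq1 m_P0 m31 w30 w240; rewrite v2_E //.
  have cE (c : int) (k : nat) : -1 + ((omega 3 m)%:Z + k%:Z) = c ->
    ((-1)%:E + (((omega 3 m)%:Z)%:E + (k%:Z)%:E))%E = c%:E by move=> <-.
  by split=> [|->|->]; [rewrite !inE => /or4P[] /eqP -> | |]; apply: cE => /=; lia.
- move=> w240 w31; have -> := gamma_ii HA m_odd m_neq1 m_P0 m31 w240 w31.
  (* G is a unit, so this summand has valuation exactly omega_1 + omega_5; unless that equals the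
     valuation of E, the smaller one decides. *)
  have v2wG : v2 (2 ^+ (omega 1 m + omega 5 m) * G_ A) = ((omega 1 m + omega 5 m)%N%:Z)%:E.
    by rewrite v2_pow2 v2_G // adde0.
  have assoc (x : \bar int) : ((-1)%:E + (((omega 3 m)%:Z)%:E + x)
      = ((omega 3 m)%:Z - 1)%:E + x)%E by rewrite addeA -EFinD addrC.
  split=> [lt|eq|lt]; rewrite assoc.
  + by rewrite [E_ A _ + _]addrC v2_add_lt v2wG.
  + by rewrite /delta -eq /=.
  by rewrite v2_add_lt // v2wG.
- exact: gamma_iii.
by move=> w30 w20 w40 _; exact: gamma_iv.
Qed.
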